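(* Let $V$ be a stable representation of a torus $T$. Then $V$ is cofree if and only if $V$ is coprincipal.
   Context: Work over an algebraically closed field $K$ of characteristic $0$; a torus is $T\cong\mathbb{G}_m^r$ and representations are finite-dimensional and rational. For a representation $V$ of a reductive group $G$, write $V/G=\operatorname{Spec} K[V]^G$ and let $\pi\colon V\to V/G$ be the quotient map. A vector $v\in V$ is $G$-stable if the orbit $Gv$ is closed and $v$ is not contained in the closure of any other orbit. The set $V^s$ of stable vectors is Zariski open; $V$ is a stable representation if $V^s\neq\varnothing$. The closed set $V^{\mathrm{sss}}=V\setminus V^s$ is the strictly semi-stable locus. A stable representation $V$ of a connected reductive group is pure if $\pi(V^{\mathrm{sss}})$ is pure of codimension one in $V/G$ (vacuously true if $V^{\mathrm{sss}}=\varnothing$). It is coprincipal if it is pure and every irreducible component of $V^{\mathrm{sss}}$ (with its reduced subscheme structure) maps under $\pi$ to a principal divisor of $V/G$. $V$ is coregular if $V/G$ is smooth, and cofree if it is coregular and $\pi\colon V\to V/G$ is flat. *)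

(* Defs.v *)
From HB Require Import structures.
From mathcomp Require Import all_boot all_order all_algebra.
From mathcomp Require Import boolp classical_sets.
From mathcomp Require Import mpoly.

Set Implicit Arguments.
Unset Strict Implicit.
Unset Printing Implicit Defensive.

Import GRing.Theory.
Local Open Scope ring_scope.
Local Open Scope classical_set_scope.

(* Zariski topology on a set X of closed points, given a K-algebra F of regular
   functions on X; [ev f x] is the value of f at x. *)
Section Zariski.
Variables (K : fieldType) (F X : Type) (ev : F -> X -> K).

Definition zlocus (S : set F) : set X :=
  [set x | forall f, S f -> ev f x = 0].

Definition zclosed (C : set X) : Prop := exists S : set F, C = zlocus S.

Definition zclosure (Y : set X) : set X :=
  [set x | forall C, zclosed C -> Y `<=` C -> C x].

Definition zirreducible (Y : set X) : Prop :=
  Y !=set0 /\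
  forall C D, zclosed C -> zclosed D -> Y `<=` C `|` D -> Y `<=` C \/ Y `<=` D.

Definition zcomponent (S Y : set X) : Prop :=
  [/\ Y `<=` S, zirreducible Y
    & forall Y', zirreducible Y' -> Y `<=` Y' -> Y' `<=` S -> Y' = Y].

(* Strict chains Y = Z 0 < Z 1 < ... < Z k of irreducible closed subsets. *)
Definition zchain (Y : set X) (k : nat) (Z : nat -> set X) : Prop :=
  [/\ Z 0%N = Y,
      forall i, (i <= k)%N -> zclosed (Z i) /\ zirreducible (Z i)
    & forall i, (i < k)%N -> Z i `<=` Z i.+1 /\ Z i <> Z i.+1].

Definition zcodim (Y : set X) (k : nat) : Prop :=
  (exists Z, zchain Y k Z) /\ (forall m Z, zchain Y m Z -> (m <= k)%N).

Definition pure_codim (S : set X) (k : nat) : Prop :=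
  forall Y, zcomponent S Y -> zcodim Y k.

End Zariski.

Section CommutativeAlgebra.

Definition finitely_presented (K : fieldType) (A : comAlgType K) : Prop :=
  exists (m : nat) (q : {lrmorphism {mpoly K[m]} -> A}) (s : seq {mpoly K[m]}),
    (forall a, exists p, q p = a) /\
    (forall p, q p = 0 <->
       exists c : nat -> {mpoly K[m]}, p = \sum_(i < size s) c i * s`_i).

(* Infinitesimal lifting along surjections B -> C with square-zero kernel. *)
Definition formally_smooth (K : fieldType) (A : comAlgType K) : Prop :=
  forall (B C : comAlgType K) (q : {lrmorphism B -> C}),
    (forall c, exists b, q b = c) ->
    (forall x y, q x = 0 -> q y = 0 -> x * y = 0) ->
    forall f : {lrmorphism A -> C},
    exists g : {lrmorphism A -> B}, forall a, q (g a) = f a.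

(* Smoothness of Spec A over K (EGA IV, 17.3.1). *)
Definition smooth_algebra (K : fieldType) (A : comAlgType K) : Prop :=
  finitely_presented A /\ formally_smooth A.

Variables (A B : comNzRingType) (f : {rmorphism A -> B}).

(* B is regarded as an A-module through f. *)
Definition bilinear_along (N Q : lmodType A) (b : N -> B -> Q) : Prop :=
  [/\ forall y, linear (fun x => b x y),
      forall x y y', b x (y + y') = b x y + b x y'
    & forall a x y, b x (f a * y) = a *: b x y].

(* The sequence s of pairs (x, y) stands for the element \sum x (x) y of the
   tensor product of N and B over A; by the universal property this element is
   zero iff every bilinear map kills it. *)
Definition tensor_eq0 (N : lmodType A) (s : seq (N * B)) : Prop :=
  forall (Q : lmodType A) (b : N -> B -> Q),
    bilinear_along b -> \sum_(u <- s) b u.1 u.2 = 0.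

(* Tensoring with B over A preserves injectivity. *)
Definition flat_morphism : Prop :=
  forall (N N' : lmodType A) (phi : {linear N -> N'}), injective phi ->
  forall s : seq (N * B),
    tensor_eq0 [seq (phi u.1, u.2) | u <- s] -> tensor_eq0 s.

End CommutativeAlgebra.

(* K-points of the torus G_m^r. *)
Definition torus (K : fieldType) (r : nat) : set {ffun 'I_r -> K} :=
  [set t | forall i, t i != 0].

(* Rational representations of G_m^r on K^n; only the values of [rep_mx] on
   the torus are meaningful. The regular functions on G_m^r are the quotients
   of polynomials by powers of the product of the coordinates. *)
Record torus_rep (K : fieldType) (r n : nat) := TorusRep {
  rep_mx :> {ffun 'I_r -> K} -> 'M[K]_n;
  rep_mx1 : rep_mx [ffun => 1] = 1%:M;
  rep_mxM : forall s t, torus s -> torus t ->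
    rep_mx [ffun i => s i * t i] = rep_mx s *m rep_mx t;
  rep_mx_regular : forall i j, exists (p : {mpoly K[r]}) (N : nat),
    forall t, torus t -> rep_mx t i j = p.@[t] / (\prod_k t k) ^+ N
}.

Definition point_eval (K : fieldType) (n : nat)
  (p : {mpoly K[n]}) (v : 'cV[K]_n) : K := p.@[fun i => v i 0].

Section Representation.
Variables (K : fieldType) (r n : nat) (V : torus_rep K r n).

Definition invariant : {pred {mpoly K[n]}} := fun p =>
  `[< forall t v, torus t -> point_eval p (V t *m v) = point_eval p v >].

Fact invariant_subalg : subalg_closed invariant.
Proof.
split=> [|a p q|p q].
- by apply/asboolP=> t v _; rewrite /point_eval !rmorph1.
- move=> /asboolP Ip /asboolP Iq; apply/asboolP=> t v Tt.
  have:= (Ip t v Tt, Iq t v Tt); rewrite /point_eval => -[ep eq].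
  by rewrite !mevalD !mevalZ ep eq.
- move=> /asboolP Ip /asboolP Iq; apply/asboolP=> t v Tt.
  have:= (Ip t v Tt, Iq t v Tt); rewrite /point_eval => -[ep eq].
  by rewrite !mevalM ep eq.
Qed.

HB.instance Definition _ :=
  GRing.isSubalgClosed.Build K {mpoly K[n]} invariant invariant_subalg.

(* The K-algebra K[V]^T. *)
Record inv_ring := InvRing { inv_val : {mpoly K[n]}; _ : inv_val \in invariant }.

HB.instance Definition _ := [isSub for inv_val].
HB.instance Definition _ := [Choice of inv_ring by <:].
HB.instance Definition _ := [SubChoice_isSubComNzRing of inv_ring by <:].
HB.instance Definition _ := [SubZmodule_isSubLmodule of inv_ring by <:].
HB.instance Definition _ := [SubNzRing_SubLmodule_isSubLalgebra of inv_ring by <:].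
HB.instance Definition _ := [SubLalgebra_isSubAlgebra of inv_ring by <:].

(* The closed points of V/T = Spec K[V]^T, as K-algebra morphisms to K; these
   are all the closed points when K is algebraically closed. *)
Definition quotient_pt : Type := {lrmorphism inv_ring -> K | *%R}.

Definition quotient_eval (a : inv_ring) (x : quotient_pt) : K := x a.

Definition eval_inv (v : 'cV[K]_n) (a : inv_ring) : K :=
  point_eval (\val a) v.

HB.instance Definition _ v := GRing.RMorphism.copy (eval_inv v)
  (meval (fun i => v i 0) \o (\val : inv_ring -> {mpoly K[n]})).
HB.instance Definition _ v := GRing.Linear.copy (eval_inv v)
  (meval (fun i => v i 0) \o (\val : inv_ring -> {mpoly K[n]})).

Definition quotient_map (v : 'cV[K]_n) : quotient_pt := eval_inv v.

Definition orbit (v : 'cV[K]_n) : set 'cV[K]_n :=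
  [set V t *m v | t in @torus K r].

(* Stability in the sense of closed orbits; finiteness of the stabiliser is
   not required. *)
Definition stable_vector (v : 'cV[K]_n) : Prop :=
  zclosed (@point_eval K n) (orbit v) /\
  forall w, orbit w <> orbit v -> ~ zclosure (@point_eval K n) (orbit w) v.

Definition stable_locus : set 'cV[K]_n := [set v | stable_vector v].

Definition sss_locus : set 'cV[K]_n := ~` stable_locus.

Definition stable_rep : Prop := stable_locus !=set0.

Definition pure_rep : Prop :=
  stable_rep /\ pure_codim quotient_eval (quotient_map @` sss_locus) 1.

(* A closed subset of V/T, with its reduced structure, is a principal divisor
   when its ideal is generated by one nonzero element. *)
Definition principal_divisor (Y : set quotient_pt) : Prop :=
  zclosed quotient_eval Y /\
  exists f : inv_ring, f <> 0 /\
    forall a, (forall x, Y x -> quotient_eval a x = 0) <-> exists b, a = b * f.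

Definition coprincipal : Prop :=
  pure_rep /\
  forall Z, zcomponent (@point_eval K n) sss_locus Z ->
    principal_divisor (quotient_map @` Z).

Definition coregular : Prop := smooth_algebra inv_ring.

Definition cofree : Prop :=
  coregular /\
  flat_morphism (\val : inv_ring -> {mpoly K[n]}).

End Representation.

(* Main.v *)
From HB Require Import structures.
From mathcomp Require Import all_boot all_order all_algebra.
From mathcomp Require Import boolp classical_sets functions.
From mathcomp Require Import zify ring mpoly.
Require Import Defs.

(** A rational representation of a torus is diagonalizable (torus_rep_diag), so
    after a linear change of coordinates t acts on the i-th coordinate y_i
    through a character t^(chi i). The invariants are then spanned by the
    monomials y^u whose exponent u lies in the monoid M of the solutions in
    naturals of sum_i u_i chi_i = 0 (invariantP). Both sides of the equivalence
    turn out to say the same thing about M: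

      for every i, the set of the u in M with u_i > 0 has a least element mu_i
      for the coordinatewise order (has_minima).

    Under this condition two different mu_i have disjoint supports and the
    distinct mu_i freely generate M (mu_block, mu_induction).

    Cofreeness. Assume that the quotient map is flat, let u, v be in M and let
    s be their coordinatewise maximum. The relation
    y^u * y^(s - u) = y^v * y^(s - v) must come from relations with invariant
    coefficients, and this forces s to lie in M (flat_lattice). So M is closed
    under maxima, hence under minima, and mu_i is the minimum of all u with
    u_i > 0; there are such u because V is stable (lattice_minima). Conversely,
    if the mu_i exist then M is closed under maxima (minima_lattice), every
    exponent w has a greatest minorant in M, and the monomials for which this
    minorant is 0 form a basis of K[V] over the invariants (lattice_flat). The
    invariant ring is the polynomial ring on the y^(mu_i), hence smooth
    (minima_coregular).

    Coprincipality. Whether v is stable depends only on its support: v is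
    stable iff its support I is spanning, that is iff for every j some element
    of M has support I + j (stable_vectorP). Hence the components of the
    strictly semistable locus are the coordinate subspaces K^J, of the vectors
    supported in J, for the maximal nonspanning sets J (sss_component). If the
    image of K^J is a principal divisor then its equation is, up to a scalar, a
    monomial y^m, where m is the least element of M whose support is not
    contained in J (principal_least). A combinatorial argument derives
    the existence of all mu_i from that of these m (max_nonspanning_minima).
    Conversely, if the mu_i exist, then the components are hyperplanes y_c = 0
    (max_nonspanning_wall), and the image of such a hyperplane is the
    irreducible principal divisor y^(mu_c) = 0 of codimension one
    (image_wall, divisor_ideal, divisor_codim). *)

Set Implicit Arguments.
Unset Strict Implicit.
Unset Printing Implicit Defensive.

Import GRing.Theory Num.Theory.

(** * Saturated monoids of exponents *)

Section Monoids.
Variable n : nat.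
Implicit Types (u v w m : 'X_{1..n}) (i j c : 'I_n) (I J : {set 'I_n}).

Definition esupp u : {set 'I_n} := [set i | u i != 0%N].

Lemma esupp0 : esupp 0%MM = finset.set0.
Proof. by apply/setP=> i; rewrite !inE mnm0E. Qed.

Lemma esuppD u v : esupp (u + v)%MM = esupp u :|: esupp v.
Proof. by apply/setP=> i; rewrite !inE mnmDE addn_eq0 negb_and. Qed.

Lemma esupp_le u v : (u <= v)%MM -> esupp u \subset esupp v.
Proof.
move=> /mnm_lepP le_uv; apply/fintype.subsetP=> i; rewrite !inE -!lt0n.
by move/leq_trans; apply.
Qed.

Lemma esupp_setC1 c u : ~~ (esupp u \subset ~: [set c]) = (u c != 0%N).
Proof. by rewrite -finset.disjoints_subset disjoint_sym disjoints1 negbK inE. Qed.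

(** The closure properties of N^n intersected with a subspace of Q^n. *)
Record saturated (M : pred 'X_{1..n}) : Prop := Saturated {
  sat0 : M 0%MM;
  satD : forall u v, M u -> M v -> M (u + v)%MM;
  satB : forall u v, M u -> M v -> (v <= u)%MM -> M (u - v)%MM;
  sat_root : forall u k, M (u *+ k.+1)%MM -> M u
}.

Lemma ex_mdeg_min (P : 'X_{1..n} -> Prop) : (exists u, P u) ->
  exists2 u, P u & forall v, P v -> (mdeg u <= mdeg v)%N.
Proof.
case=> u Pu; pose Q k := `[< exists2 u, P u & mdeg u = k >].
have exQ : exists k, Q k by exists (mdeg u); apply/asboolP; exists u.
case: (ex_minnP exQ) => k /asboolP[w Pw <-] min_w.
by exists w => // v Pv; apply: min_w; apply/asboolP; exists v.
Qed.

Variables (M : pred 'X_{1..n}) (satM : saturated M).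

Definition lattice_closed := forall u v, M u -> M v -> M (mlcm u v).

Definition least_in (P : 'X_{1..n} -> Prop) m :=
  [/\ M m, P m & forall u, M u -> P u -> (m <= u)%MM].

Definition has_minima := forall i, exists m, least_in (fun u => u i != 0%N) m.

(** For M the relations between the characters chi_i, this says that the chi_i
    with i in I generate as a cone the whole vector space spanned by all the
    chi_i. Stating it with I + j for all j makes it a property of M alone. *)
Definition spanning I := forall j, exists2 u, M u & esupp u = j |: I.

Lemma spanning_supp I : spanning I -> exists2 u, M u & esupp u = I.
Proof.
move=> spI; have [->|[i iI]] := set_0Vmem I.
  by exists 0%MM; [apply: sat0 | apply: esupp0].
by have [u Mu su] := spI i; exists u => //; rewrite su; apply/finset.setUidPr; rewrite finset.sub1set.
Qed.

Lemma sat_sum (T : Type) (s : seq T) (F : T -> 'X_{1..n}) (p : pred T) :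
  (forall x, p x -> M (F x)) -> M (\sum_(x <- s | p x) F x)%MM.
Proof.
by move=> MF; apply: (big_ind (fun u => M u)) => //; [apply: sat0 | apply: satD].
Qed.

Lemma esupp_sum (T : finType) (p : pred T) (F : T -> 'X_{1..n}) :
  esupp (\sum_(x | p x) F x)%MM = (\bigcup_(x | p x) esupp (F x))%SET.
Proof. exact: (big_morph _ esuppD esupp0). Qed.

Lemma spanning_sub I J : I \subset J -> spanning I -> spanning J.
Proof.
move=> sIJ spI j.
(* The required element is a sum of elements of supports k + I, k in j + J. *)
pose F k := s2val (cid2 (spI k)).
have MF k : M (F k) by rewrite /F; case: cid2.
have sF k : esupp (F k) = k |: I by rewrite /F; case: cid2.
have [u0 Mu0 su0] := spanning_supp spI.
exists (u0 + \sum_(k in j |: J) F k)%MM.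
  by apply: satD => //; apply: sat_sum.
rewrite esuppD esupp_sum su0; apply/setP=> k; rewrite inE.
apply/orP/idP=> [[kI|/bigcupP[l lJ]]|kJ].
- by rewrite !inE (fintype.subsetP sIJ _ kI) orbT.
- by rewrite sF !inE => /orP[/eqP->|/(fintype.subsetP sIJ)->]; rewrite ?orbT // -in_setU1.
- by right; apply/bigcupP; exists k => //; rewrite sF !inE eqxx.
Qed.

Lemma spanningT_ex : spanning finset.setT -> forall i, exists2 u, M u & u i != 0%N.
Proof.
move=> spT i; have [u Mu su] := spT i; exists u => //.
by have: i \in esupp u by [rewrite su !inE eqxx]; rewrite inE.
Qed.

Lemma mdeg_le u v : (u <= v)%MM -> (mdeg u <= mdeg v)%N.
Proof. by move=> /submK <-; rewrite mdegD leq_addl. Qed.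

Lemma mdeg_le_eq u v : (u <= v)%MM -> (mdeg v <= mdeg u)%N -> u = v.
Proof.
move=> le_uv; rewrite -{1}(submK le_uv) mdegD -{2}[mdeg u]add0n leq_add2r leqn0.
by rewrite mdeg_eq0 => /eqP d0; rewrite -(submK le_uv) d0 add0m.
Qed.

(** An element of least degree among the u with u_i > 0 is least for the
    coordinatewise order, since replacing it by its minimum with another such
    element cannot lower the degree. *)
Lemma lattice_minima : lattice_closed -> spanning finset.setT -> has_minima.
Proof.
move=> latM spT i.
have /ex_mdeg_min[m [Mm mi] min_m] : exists u, M u /\ u i != 0%N.
  by have [u] := spanningT_ex spT i; exists u.
exists m; split=> // u Mu ui.
(* The minimum of m and u is m + u minus their maximum. *)
have Mmin : M ((m + u) - mlcm m u)%MM.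
  apply: satB => //; [exact: satD | exact: latM |].
  by rewrite lem_mlcm lem_addr lem_addl.
have minE k : ((m + u) - mlcm m u)%MM k = minn (m k) (u k).
  by rewrite mnmBE mnmDE mnmE; case: (leqP (m k) (u k)) => _;
     rewrite ?addnK // addnC addnK.
have le_m : ((m + u) - mlcm m u <= m)%MM.
  by apply/mnm_lepP=> k; rewrite minE geq_minl.
have mE : ((m + u) - mlcm m u)%MM = m.
  apply: mdeg_le_eq => //; apply: min_m; split=> //.
  by rewrite minE -lt0n leq_min !lt0n mi.
by apply/mnm_lepP=> k; rewrite -{1}mE minE geq_minr.
Qed.

Section Minima.
Variable mu : 'I_n -> 'X_{1..n}.
Hypothesis muP : forall i, least_in (fun u => u i != 0%N) (mu i).

Lemma mu_in i : M (mu i). Proof. by case: (muP i). Qed.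
Lemma mu_diag i : mu i i != 0%N. Proof. by case: (muP i). Qed.
Lemma mu_le i u : M u -> u i != 0%N -> (mu i <= u)%MM.
Proof. by case: (muP i) => _ _; apply. Qed.

(** The supports of the minima partition the indices into blocks. If
    (mu i) j > 0 then mu j <= mu i; were (mu j) i = 0, the difference
    mu i - mu j would be a smaller element with nonzero i-th coordinate. *)
Lemma mu_block i j : mu i j != 0%N -> mu j = mu i.
Proof.
move=> ij; have le_ji := mu_le (mu_in i) ij.
have [ji|ji] := eqVneq (mu j i) 0%N; last first.
  apply/mnmP=> k; apply/anti_leq/andP.
  by split; [move: le_ji | move: (mu_le (mu_in j) ji)] => /mnm_lepP.
have Mb : M (mu i - mu j)%MM by apply: satB => //; apply: mu_in.
have /mnm_lepP/(_ j) : (mu i <= mu i - mu j)%MM.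
  by apply: mu_le => //; rewrite mnmBE ji subn0 mu_diag.
rewrite mnmBE => le_i; have := mu_diag j; have /mnm_lepP/(_ j) := le_ji.
by lia.
Qed.

(** The minima generate M: subtract mu i as long as some coordinate i is
    nonzero. *)
Lemma mu_induction (P : 'X_{1..n} -> Prop) : P 0%MM ->
  (forall i u, M u -> P u -> P (mu i + u)%MM) -> forall u, M u -> P u.
Proof.
move=> P0 PD u; have [k] := ubnP (mdeg u); elim: k u => // k IHk u lt_uk Mu.
have [->//|/eqP u0] := eqVneq u 0%MM.
have [i ui] : exists i, u i != 0%N.
  apply/existsP; apply: contra_notT u0 => /existsPn u0; apply/mnmP=> i.
  by rewrite mnm0E; apply/eqP; rewrite -[_ == _]negbK u0.
have le_i := mu_le Mu ui; have Mb := satB satM Mu (mu_in i) le_i.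
rewrite -(submK le_i) addmC; apply: PD => //; apply: IHk => //.
have := mdegD (u - mu i)%MM (mu i); rewrite submK // => uE.
have: (0 < mdeg (mu i))%N.
  by rewrite lt0n mdeg_eq0; apply: contraNneq (mu_diag i) => ->; rewrite mnm0E.
lia.
Qed.

(** Blocks are disjoint, so the maximum of mu i + u and v can be computed block
    by block: either v also dominates mu i, or v vanishes on its support. *)
Lemma minima_lattice : lattice_closed.
Proof.
move=> u v Mu; elim/mu_induction: Mu v => [|i {}u Mu IHu] v Mv.
  by rewrite mlc0m.
have [vi|vi] := eqVneq (v i) 0%N; last first.
  have le_i := mu_le Mv vi.
  have -> : mlcm (mu i + u)%MM v = (mu i + mlcm u (v - mu i))%MM.
    apply/mnmP=> k; move/mnm_lepP/(_ k): le_i; rewrite !mnmE; lia.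
  by apply: satD; [|apply: mu_in|apply: IHu; apply: satB; rewrite ?mu_in].
have v0 k : mu i k != 0%N -> v k = 0%N.
  move=> ik; apply/eqP; apply: contraTT isT => vk.
  have /mnm_lepP/(_ i) := mu_le Mv vk.
  by rewrite (mu_block ik) vi leqn0 (negPf (mu_diag i)).
have -> : mlcm (mu i + u)%MM v = (mu i + mlcm u v)%MM.
  apply/mnmP=> k; rewrite !mnmE.
  by have [->|/v0->] := eqVneq (mu i k) 0%N; lia.
by apply: satD; rewrite ?mu_in ?IHu.
Qed.

(** If removing c leaves a spanning set then the support of mu c is {c}: an
    element of M that vanishes exactly at c would otherwise dominate mu c. So
    when this holds for all c outside I, sums of minima have the supports that
    spanning requires. *)
Lemma minima_spanning I :
  (forall c, c \notin I -> spanning (~: [set c])) -> spanning I.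
Proof.
move=> spI.
have mu_off c k : c \notin I -> mu c k != 0%N -> k = c.
  move=> cI ck; have [u Mu su] := spanning_supp (spI c cI).
  apply/eqP; apply: contraTT isT => kc.
  have uk : u k != 0%N by have: k \in esupp u by [rewrite su !inE]; rewrite inE.
  have /mnm_lepP/(_ c) := mu_le Mu uk; rewrite (mu_block ck).
  have : c \notin esupp u by rewrite su !inE eqxx.
  by rewrite inE negbK => /eqP->; rewrite leqn0 (negPf (mu_diag c)).
move=> j; exists (mu j + \sum_(i in I) mu i)%MM.
  by apply: satD; rewrite ?mu_in //; apply: sat_sum => *; apply: mu_in.
have mem_off i k : mu i k != 0%N -> k \notin I -> i = k.
  by move=> ik kI; apply: (mu_off k) => //; rewrite (mu_block ik) mu_diag.
rewrite esuppD esupp_sum; apply/setP=> k; rewrite inE; apply/orP/idP.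
  case=> [|/bigcupP[i iI]]; rewrite inE => ik.
    rewrite !inE; have [kI|kI] := boolP (k \in I); rewrite ?orbT //.
    by rewrite (mem_off j k ik kI) eqxx.
  rewrite !inE; have [kI|kI] := boolP (k \in I); rewrite ?orbT //.
  by case/negP: (kI); rewrite -(mem_off i k ik kI).
rewrite !inE => /orP[/eqP->|kI]; first by left; rewrite mu_diag.
by right; apply/bigcupP; exists k; rewrite ?inE ?mu_diag.
Qed.

End Minima.

Definition max_nonspanning J :=
  ~ spanning J /\ forall J', ~ spanning J' -> J \subset J' -> J' = J.

Lemma ex_max_nonspanning I : ~ spanning I ->
  exists2 J, max_nonspanning J & I \subset J.
Proof.
move=> nsI; pose p := [pred J : {set 'I_n} | `[< ~ spanning J >]].
have [J /maxsetP[/asboolP nsJ maxJ] sIJ] := @maxset_exists _ p I (asboolT nsI).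
exists J => //; split=> // J' nsJ' sJJ'; apply: maxJ => //; exact/asboolP.
Qed.

(** Let C be the set of the indices c whose complement is not spanning; these
    complements are maximal nonspanning, which gives mu c for c in C. For i
    outside C, minimality of degree shows that U_(i) itself is in M. *)
Lemma max_nonspanning_minima : spanning finset.setT ->
  (forall J, max_nonspanning J ->
     exists m, least_in (fun u => ~~ (esupp u \subset J)) m) ->
  has_minima.
Proof.
move=> spT minJ.
pose C := [set c | `[< ~ spanning (~: [set c]) >]].
have maxC c : c \in C -> max_nonspanning (~: [set c]).
  rewrite inE => /asboolP nsc; split=> // J nsJ sJ.
  apply/eqP; rewrite finset.eqEsubset sJ andbT; apply/fintype.subsetP=> k kJ.
  rewrite !inE; apply: contra_notN nsJ => /eqP kc.
  suff -> : J = finset.setT by [].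
  apply/setP=> l; rewrite inE; have [->|lc] := eqVneq l c; first by rewrite -kc.
  by apply: (fintype.subsetP sJ); rewrite !inE.
(* For i outside C some element of M has support the complement of i, and it
   dominates m unless i is outside the support of m. *)
have supC J m : max_nonspanning J ->
    least_in (fun u => ~~ (esupp u \subset J)) m -> esupp m \subset C.
  move=> maxJ [Mm _ minm]; apply/fintype.subsetP=> i; rewrite !inE => mi.
  move=> spi; have [u Mu su] := spanning_supp spi.
  have /minm-/(_ Mu)/mnm_lepP/(_ i) : ~~ (esupp u \subset J).
    rewrite su; apply/negP=> sJ; case: maxJ => nsJ _.
    exact/nsJ/(spanning_sub sJ).
  have: i \notin esupp u by rewrite su !inE eqxx.
  by rewrite inE negbK => /eqP->; rewrite leqn0 (negPf mi).
(* Otherwise C lies in a maximal J, and the support of m is in C, hence in J. *)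
have spC : spanning C.
  apply: contrapT => /ex_max_nonspanning[J maxJ sCJ].
  have [m minm] := minJ J maxJ; case: (minm) => _ /negP nsm _; apply: nsm.
  exact: fintype.subset_trans (supC _ _ maxJ minm) sCJ.
move=> i; have [iC|iC] := boolP (i \in C).
  have [m [Mm m0 minm]] := minJ _ (maxC i iC); exists m.
  split=> // [|u Mu ui]; first by rewrite -esupp_setC1.
  by apply: minm; rewrite ?esupp_setC1.
have [u Mu su] := spC i.
have /ex_mdeg_min[a [Ma ai sa] mina] :
    exists a, [/\ M a, a i != 0%N & esupp a \subset i |: C].
  exists u; split=> //; last by rewrite su.
  by have: i \in esupp u by [rewrite su !inE eqxx]; rewrite inE.
(* Subtracting the least element attached to k in C would lower the degree
   of a without changing its i-th coordinate. *)
have aE k : k != i -> a k = 0%N.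
  move=> ki; apply/eqP; apply: contraTT isT => ak.
  have kC : k \in C.
    have : k \in i |: C by apply: (fintype.subsetP sa); rewrite inE.
    by rewrite in_setU1 (negPf ki).
  have [m minm] := minJ _ (maxC k kC); case: (minm) => Mm m0 le_m.
  rewrite esupp_setC1 in m0.
  have le_ma : (m <= a)%MM by apply: le_m; rewrite ?esupp_setC1.
  have mi : m i = 0%N.
    apply/eqP; rewrite -[_ == _]negbK; apply: contra iC => mi.
    by apply: (fintype.subsetP (supC _ _ (maxC k kC) minm)); rewrite inE.
  have /mina : [/\ M (a - m)%MM, (a - m)%MM i != 0%N & esupp (a - m)%MM \subset i |: C].
    split; [exact: satB | by rewrite mnmBE mi subn0 |].
    exact: fintype.subset_trans (esupp_le (lem_subr _ _)) sa.
  have := mdegD (a - m)%MM m; rewrite submK // => aE.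
  have: (0 < mdeg m)%N.
    by rewrite lt0n mdeg_eq0; apply: contraNneq m0 => ->; rewrite mnm0E.
  lia.
have MU : M U_(i)%MM.
  apply: (@sat_root _ satM _ (a i).-1); rewrite prednK ?lt0n //.
  suff -> : (U_(i) *+ a i)%MM = a by [].
  apply/mnmP=> k; rewrite mulmnE mnm1E; have [<-|ik] := eqVneq i k.
    by rewrite mul1n.
  by rewrite mul0n aE // eq_sym.
exists U_(i)%MM; split=> // [|v Mv vi]; first by rewrite mnm1E eqxx.
by rewrite lep1mP.
Qed.

End Monoids.

Local Open Scope ring_scope.

(** * Diagonalizing a rational representation of a torus *)

Lemma base_expansion_inj D n (f g : nat -> nat) :
  (forall i, (i < n)%N -> (f i < D)%N) -> (forall i, (i < n)%N -> (g i < D)%N) ->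
  (\sum_(i < n) f i * D ^ i = \sum_(i < n) g i * D ^ i)%N ->
  forall i, (i < n)%N -> f i = g i.
Proof.
elim: n f g => [|n IHn] f g fD gD //.
have shift (h : nat -> nat) :
    (\sum_(i < n.+1) h i * D ^ i = (\sum_(i < n) h i.+1 * D ^ i) * D + h 0)%N.
  rewrite big_ord_recl expn0 muln1 addnC big_distrl /=; congr addn.
  by apply: eq_bigr => i _; rewrite -mulnA -expnSr.
rewrite !shift => eq_fg.
have D0 : (0 < D)%N by apply: leq_ltn_trans (fD 0%N _).
have f0 : f 0%N = g 0%N.
  by have /(congr1 (modn^~ D)) := eq_fg; rewrite !modnMDl !modn_small ?fD ?gD.
move: eq_fg; rewrite f0 => /addIn/eqP; rewrite eqn_pmul2r // => /eqP eq_S.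
case=> // i lt_in; apply: (IHn (f \o S) (g \o S)) => // j lt_jn; [exact: fD | exact: gD].
Qed.

Section TorusPolynomials.
Variable K : closedFieldType.

(** Kronecker substitution: sending the i-th variable to x^(D^i), with D larger
    than all exponents, keeps distinct monomials distinct, so a nonzero p gives
    a nonzero univariate polynomial, which does not vanish at some x <> 0. *)
Lemma mpoly_torus_eq0 n (p : {mpoly K[n]}) :
  (forall t : {ffun 'I_n -> K}, torus t -> p.@[t] = 0) -> p = 0.
Proof.
move=> p0; apply/eqP; apply: contra_eqT isT => nz_p.
have [D leD] : exists D, (msize p <= D)%N by exists (msize p).
pose code (m : 'X_{1..n}) := (\sum_(i < n) m i * D ^ i)%N.
pose F := mmap (@polyC K) (fun i : 'I_n => 'X^(D ^ i)) p.
have mlt m i : m \in msupp p -> (m i < D)%N.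
  move=> /msize_mdeg_lt/leq_trans/(_ leD); apply: leq_ltn_trans.
  by rewrite mdegE (bigD1 i) //= leq_addr.
have code_inj : {in msupp p &, injective code}.
  move=> m m' mp m'p eq_c; apply/mnmP=> i.
  pose ext (u : 'X_{1..n}) k := if insub k is Some j then u j else 0%N.
  have extE (u : 'X_{1..n}) (j : 'I_n) : ext u j = u j by rewrite /ext valK.
  have extS u : (\sum_(i < n) ext u i * D ^ i = code u)%N.
    by apply: eq_bigr => j _; rewrite extE.
  have lt_ext u k : u \in msupp p -> (k < n)%N -> (ext u k < D)%N.
    by move=> up kn; rewrite -[k]/(val (Ordinal kn)) extE mlt.
  rewrite -!extE; apply: (@base_expansion_inj D n) (ltn_ord i).
  - by move=> k; apply: lt_ext.
  - by move=> k; apply: lt_ext.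
  - by rewrite !extS.
have FE : F = \sum_(m <- msupp p) p@_m *: 'X^(code m).
  apply: eq_bigr => m _; rewrite mul_polyC; congr (_ *: _).
  rewrite /mmap1 /code; rewrite (big_morph _ (exprD 'X) (expr0 'X)).
  by apply: eq_bigr => i _; rewrite -exprM mulnC.
have nzF : F != 0.
  have [m mp] : exists m, m \in msupp p.
    by exists (mlead p); apply: mlead_supp.
  apply: contra_eq_neq (mcoeff_msupp p m) => F0.
  have : F`_(code m) = 0 by rewrite F0 coef0.
  rewrite FE coef_sum (bigD1_seq m) ?msupp_uniq //= big1_seq => [|m' /andP[m'm m'p]].
    by rewrite coefZ coefXn eqxx mulr1 addr0 => ->; rewrite eqxx mp.
  rewrite coefZ coefXn; case: eqVneq; rewrite ?mulr0 // => /code_inj mm'.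
  by rewrite mm' ?eqxx in m'm.
(* The factor 'X forces x <> 0, so that the point obtained is in the torus. *)
have /closed_nonrootP[x] : F * 'X != 0 by rewrite mulf_neq0 ?polyX_eq0.
rewrite rootM negb_or rootX => /andP[Fx x0]; case/negP: Fx.
pose t := [ffun i : 'I_n => x ^+ (D ^ i)].
have /p0 : torus t by move=> i; rewrite ffunE expf_neq0.
rewrite mevalE => pt; rewrite rootE FE horner_sum; apply/eqP.
rewrite -[RHS]pt; apply: eq_bigr => m _.
rewrite hornerZ hornerXn; congr *%R.
rewrite /code (big_morph _ (exprD x) (expr0 x)).
by apply: eq_bigr => i _; rewrite ffunE -exprM mulnC.
Qed.

Lemma torus_coef_eq0 n D (c : 'X_{1..n < D} -> K) :
  (forall t : {ffun 'I_n -> K}, torus t ->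
     \sum_k c k * 'X_[bmnm k].@[t] = 0) -> forall k, c k = 0.
Proof.
move=> c0 k; pose p : {mpoly K[n]} := \sum_k c k *: 'X_[bmnm k].
have : p = 0.
  apply: mpoly_torus_eq0 => t /c0 <-; rewrite raddf_sum /=.
  by apply: eq_bigr => l _; rewrite mevalZ.
move/(congr1 (mcoeff (bmnm k))); rewrite mcoeff0 raddf_sum /= (bigD1 k) //=.
rewrite mcoeffZ mcoeffX eqxx mulr1 big1 ?addr0 // => l lk.
by rewrite mcoeffZ mcoeffX -bmeqP (negPf lk) mulr0.
Qed.

End TorusPolynomials.

Lemma idempotent_diagonalizable (F : fieldType) n (A : 'M[F]_n) :
  A *m A = A -> diagonalizable A.
Proof.
case: n A => [|n] A idA; first by rewrite thinmx0; apply: diagonalizable0.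
apply/diagonalizableP; exists [:: 0; 1].
  by rewrite /= inE eq_sym oner_eq0.
rewrite !big_cons big_nil mulr1 subr0; apply: mxminpoly_min.
rewrite rmorphM /= horner_mx_X rmorphB /= horner_mx_X horner_mx_C.
by rewrite mulrBr -mulmxE idA mulmx1 subrr.
Qed.

(** The A k are diagonal in a common basis; the k-th diagonals are orthogonal
    idempotents of K^n with sum 1, so exactly one of them is nonzero at i, and
    kappa i is its index. *)
Lemma orthogonal_idempotents_diag (F : fieldType) n (T : finType)
    (A : T -> 'M[F]_n) :
  (forall k l, A k *m A l = if k == l then A k else 0) -> \sum_k A k = 1%:M ->
  exists (P : 'M[F]_n) (kappa : 'I_n -> T), P \in unitmx /\
    forall k, A k = P *m diag_mx (\row_i (kappa i == k)%:R) *m invmx P.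
Proof.
move=> AA A1.
have /codiagonalizableP[Q Qu /allP diagQ] :
    {in [seq A k | k : T] &, forall B C, comm_mx B C} /\
    {in [seq A k | k : T], forall B, diagonalizable B}.
  split=> [_ _ /mapP[k _ ->] /mapP[l _ ->]|_ /mapP[k _ ->]].
    by rewrite /comm_mx !AA eq_sym; case: eqP => // ->.
  by apply: idempotent_diagonalizable; rewrite AA eqxx.
have Dex k : exists d : 'rV_n, Q *m A k *m invmx Q = diag_mx d.
  have /(diagonalizable_forP _ Qu) off : diagonalizable_for Q (A k).
    by apply: diagQ; apply: map_f; rewrite mem_enum.
  exists (\row_i (Q *m A k *m invmx Q) i i); apply/matrixP=> i j.
  rewrite [RHS]mxE; case: (eqVneq i j) => [<-|/off ->]; last by rewrite mulr0n.
  by rewrite mulr1n [RHS]mxE.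
pose d k := sval (cid (Dex k)).
have dE k : diag_mx (d k) = Q *m A k *m invmx Q by rewrite -(svalP (cid (Dex k))).
have dM k l i : d k 0 i * d l 0 i = if k == l then d k 0 i else 0.
  have : diag_mx (d k) *m diag_mx (d l) = if k == l then diag_mx (d k) else 0.
    rewrite !dE !mulmxA mulmxKV // -(mulmxA Q) AA.
    by case: eqP => // _; rewrite mulmx0 mul0mx.
  rewrite mulmx_diag => /matrixP/(_ i i); case: eqP => _.
    by rewrite !mxE eqxx !mulr1n.
  by rewrite !mxE eqxx !mulr1n.
have d1 i : \sum_k d k 0 i = 1.
  have : \sum_k diag_mx (d k) = 1%:M.
    rewrite (eq_bigr _ (fun k _ => dE k)) -mulmx_suml -mulmx_sumr A1 mulmx1.
    by rewrite mulmxV.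
  move/matrixP/(_ i i); rewrite summxE [RHS]mxE eqxx => d1.
  by rewrite -[RHS]d1; apply: eq_bigr => k _; rewrite mxE eqxx mulr1n.
have kex i : exists k, d k 0 i != 0.
  apply/existsP; apply: contra_eqT (d1 i) => /existsPn d0.
  by rewrite big1 1?eq_sym ?oner_eq0 // => k _; apply/eqP; rewrite -[_ == _]negbK d0.
pose kappa i := sval (cid (kex i)).
have nzk i : d (kappa i) 0 i != 0 by apply: (svalP (cid (kex i))).
exists (invmx Q), kappa; split; first by rewrite unitmx_inv.
move=> k; have -> : (\row_i (kappa i == k)%:R) = d k.
  apply/rowP=> i; rewrite mxE; have := dM (kappa i) k i.
  case: eqP => [<-|_].
    by rewrite -[RHS]mulr1 => /(mulfI (nzk i)).
  by move/eqP; rewrite mulf_eq0 (negPf (nzk i)) => /eqP.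
by rewrite dE invmxK !mulmxA mulVmx // mul1mx mulmxKV.
Qed.

Section TorusCharacters.
Variables (K : closedFieldType) (r : nat).
Implicit Types (t : {ffun 'I_r -> K}) (a b : {ffun 'I_r -> int}).

Definition tchar t a : K := \prod_j t j ^ a j.

Lemma tchar0 t : tchar t 0 = 1.
Proof. by apply: big1 => j _; rewrite ffunE expr0z. Qed.

Lemma tcharD t a b : torus t -> tchar t (a + b) = tchar t a * tchar t b.
Proof.
by move=> Tt; rewrite -big_split; apply: eq_bigr => j _; rewrite ffunE expfzDr ?Tt.
Qed.

Lemma tcharMn t a m : torus t -> tchar t (a *+ m) = tchar t a ^+ m.
Proof.
by move=> Tt; elim: m => [|m IHm]; rewrite ?tchar0 // mulrS tcharD // IHm exprS.
Qed.

Lemma tchar_neq0 t a : torus t -> tchar t a != 0.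
Proof. by move=> Tt; apply/prodf_neq0 => j _; rewrite expfz_neq0 ?Tt. Qed.

(** Clearing denominators writes V t as a finite sum of Laurent monomials with
    matrix coefficients A k. Comparing coefficients in V (s t) = V s * V t and
    in V 1 = 1 shows that the A k are orthogonal idempotents of sum 1. *)
Lemma torus_rep_diag n (V : torus_rep K r n) :
  exists (P : 'M[K]_n) (chi : 'I_n -> {ffun 'I_r -> int}), P \in unitmx /\
    forall t, torus t ->
      V t = P *m diag_mx (\row_i tchar t (chi i)) *m invmx P.
Proof.
have ex_p (ij : 'I_n * 'I_n) : exists pN : {mpoly K[r]} * nat, forall t, torus t ->
    V t ij.1 ij.2 = pN.1.@[t] / (\prod_k t k) ^+ pN.2.
  by have [p [N E]] := rep_mx_regular V ij.1 ij.2; exists (p, N).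
pose pN ij := sval (cid (ex_p ij)); pose N := (\sum_ij (pN ij).2)%N.
pose q ij := (pN ij).1 * (\prod_k 'X_k) ^+ (N - (pN ij).2).
have qE i j t : torus t -> (\prod_k t k) ^+ N * V t i j = (q (i, j)).@[t].
  move=> Tt; rewrite (svalP (cid (ex_p (i, j))) _ Tt) -/(pN _).
  rewrite rmorphM rmorphXn rmorph_prod /=.
  have -> : \prod_k ('X_k : {mpoly K[r]}).@[t] = \prod_k t k.
    by apply: eq_bigr => k _; rewrite mevalXU.
  have leN : ((pN (i, j)).2 <= N)%N by rewrite /N (bigD1 (i, j)) //= leq_addr.
  rewrite -[in LHS](subnK leN) exprD mulrCA mulfK // expf_neq0 //.
  by apply/prodf_neq0 => k _; apply: Tt.
pose D := (\sum_ij msize (q ij))%N.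
pose A (k : 'X_{1..r < D}) : 'M[K]_n := \matrix_(i, j) (q (i, j))@_k.
pose mon (k : 'X_{1..r < D}) t : K := 'X_[bmnm k].@[t].
have VE t : torus t -> (\prod_k t k) ^+ N *: V t = \sum_k mon k t *: A k.
  move=> Tt; apply/matrixP=> i j; rewrite mxE qE // summxE.
  have leD : (msize (q (i, j)) <= D)%N by rewrite /D (bigD1 (i, j)) //= leq_addr.
  rewrite (mpolywE leD) raddf_sum /=; apply: eq_bigr => k _.
  by rewrite mevalZ !mxE mulrC.
have mon_neq0 k t : torus t -> mon k t != 0.
  move=> Tt; rewrite /mon mevalX; apply/prodf_neq0 => j _.
  by rewrite expf_neq0 ?Tt.
have AA k l : A k *m A l = if k == l then A k else 0.
  have stE s t : torus s -> torus t ->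
      \sum_k mon k s *: (mon k t *: A k) = \sum_k mon k s *: (\sum_l mon l t *: (A k *m A l)).
    move=> Ts Tt; have Tst : torus [ffun i => s i * t i].
      by move=> i; rewrite ffunE mulf_neq0 ?Ts ?Tt.
    transitivity (\sum_k mon k [ffun i => s i * t i] *: A k).
      apply: eq_bigr => m _; rewrite scalerA; congr (_ *: _).
      rewrite /mon !mevalX -big_split; apply: eq_bigr => j _.
      by rewrite ffunE exprMn.
    rewrite -VE // rep_mxM //.
    have -> : \prod_k [ffun i => s i * t i] k = (\prod_k s k) * (\prod_k t k).
      by rewrite -big_split; apply: eq_bigr => k' _; rewrite ffunE.
    rewrite exprMn -scalerA scalemxAr scalemxAl !VE // mulmx_suml.
    apply: eq_bigr => m _; rewrite -scalemxAl mulmx_sumr; congr (_ *: _).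
    by apply: eq_bigr => l' _; rewrite -scalemxAr.
  apply/matrixP=> i j.
  (* Coefficient extraction, first in s and then in t. *)
  have coefk t : torus t ->
      mon k t * A k i j = \sum_l mon l t * (A k *m A l) i j.
    move=> Tt; apply/eqP; rewrite -subr_eq0; apply/eqP.
    apply: (@torus_coef_eq0 _ _ _ (fun k => mon k t * A k i j - \sum_l mon l t * (A k *m A l) i j)) => s Ts.
    have /matrixP/(_ i j) := stE s t Ts Tt; rewrite !summxE => /eqP.
    rewrite -subr_eq0 -sumrB => /eqP E0; rewrite -[RHS]E0.
    apply: eq_bigr => m _; rewrite [X in _ = X - _]mxE [X in _ = _ * X - _]mxE.
    rewrite [X in _ = _ - X]mxE summxE mulrC mulrBr; congr (_ - _ * _).
    by apply: eq_bigr => l' _; rewrite [RHS]mxE.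
  have van t : torus t ->
      \sum_l ((k == l)%:R * A k i j - (A k *m A l) i j) * mon l t = 0.
    move=> Tt; under eq_bigr => l' _ do rewrite mulrBl.
    rewrite sumrB (bigD1 k) //= eqxx mul1r big1 ?addr0 => [|m mk].
      rewrite [X in X - _]mulrC coefk // -sumrB big1 // => m _.
      by rewrite mulrC subrr.
    by rewrite eq_sym (negPf mk) !mul0r.
  have /eqP := torus_coef_eq0 van l; rewrite subr_eq0 => /eqP <-.
  by case: eqP => _; rewrite ?mul1r // mul0r mxE.
have A1 : \sum_k A k = 1%:M.
  have T1 : torus ([ffun => 1] : {ffun 'I_r -> K}) by move=> j; rewrite ffunE oner_neq0.
  have := VE _ T1; rewrite rep_mx1 (eq_bigr (fun=> 1)) => [|k _]; last by rewrite ffunE.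
  rewrite big1 // expr1n scale1r => ->; apply: eq_bigr => k _.
  rewrite /mon mevalX big1 ?scale1r // => j _.
  by rewrite ffunE expr1n.
have [P [kappa [Pu AE]]] := orthogonal_idempotents_diag AA A1.
exists P, (fun i => [ffun j => (bmnm (kappa i) j)%:Z - N%:Z]); split=> // t Tt.
have nzN : (\prod_k t k) ^+ N != 0.
  by rewrite expf_neq0 //; apply/prodf_neq0 => k _; apply: Tt.
apply: (scalerI nzN); rewrite VE // (eq_bigr _ (fun k _ => congr1 _ (AE k))).
rewrite (eq_bigr (fun k => P *m (mon k t *: diag_mx (\row_i (kappa i == k)%:R)) *m invmx P)); last first.
  by move=> k _; rewrite -scalemxAr -scalemxAl.
rewrite -mulmx_suml -mulmx_sumr scalemxAl scalemxAr; congr (_ *m _ *m _).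
apply/matrixP=> i j; rewrite summxE !mxE (bigD1 (kappa i)) //= !mxE eqxx.
rewrite big1 => [|k ki]; last by rewrite !mxE eq_sym (negPf ki) mul0rn mulr0.
rewrite addr0 !mulrnAr mulr1 mulr1n; congr (_ *+ _).
rewrite /mon mevalX /tchar -prodrXl -big_split; apply: eq_bigr => k _ /=.
by rewrite ffunE expfzDr ?Tt // -exprnN mulrCA divff ?mulr1 // expf_neq0 ?Tt.
Qed.

End TorusCharacters.

(** * The image of the torus under monomials *)

Section MonomialMap.
Variable K : closedFieldType.

(** The monomial map of exponent matrix A between tori. *)
Definition mexp m n (A : 'M[int]_(m, n)) (x : 'I_n -> K) (i : 'I_m) : K :=
  \prod_j x j ^ A i j.

Lemma mexp_neq0 m n (A : 'M[int]_(m, n)) (x : 'I_n -> K) i :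
  (forall j, x j != 0) -> mexp A x i != 0.
Proof. by move=> x0; apply/prodf_neq0 => j _; rewrite expfz_neq0. Qed.

Lemma mexp1 n (x : 'I_n -> K) : mexp 1%:M x =1 x.
Proof.
move=> i; rewrite /mexp (bigD1 i) //= big1 => [|j ji].
  by rewrite mxE eqxx expr1z mulr1.
by rewrite mxE eq_sym (negPf ji) expr0z.
Qed.

Lemma mexpM m n p (A : 'M[int]_(m, n)) (B : 'M[int]_(n, p)) (x : 'I_p -> K) :
  (forall j, x j != 0) -> mexp (A *m B) x =1 mexp A (mexp B x).
Proof.
move=> x0 i; have expz_sum (y : K) (T : finType) (F : T -> int) : y != 0 ->
    y ^ (\sum_k F k) = \prod_k y ^ F k.
  by move=> y0; apply: (big_morph _ (fun a b => expfzDr a b y0) (expr0z y)).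
rewrite /mexp; under eq_bigr => j _ do rewrite mxE expz_sum //.
rewrite exchange_big /=; apply: eq_bigr => k _.
rewrite (big_morph (fun y => y ^ A i k) (fun a b => expfzMl a b _) (exp1rz _ _)).
by apply: eq_bigr => j _; rewrite exprz_exp mulrC.
Qed.

Lemma eq_mexp m n (A : 'M[int]_(m, n)) (x y : 'I_n -> K) :
  x =1 y -> mexp A x =1 mexp A y.
Proof. by move=> xy i; apply: eq_bigr => j _; rewrite xy. Qed.

Lemma root_exists (z : K) (k : nat) : (0 < k)%N -> exists x, x ^+ k = z.
Proof.
move=> k0; have /closed_rootP[x] : size ('X^k - z%:P) != 1%N.
  by rewrite size_XnsubC // eqSS -lt0n.
by rewrite rootE !hornerE subr_eq0 => /eqP; exists x.
Qed.

Lemma root_int_exists (z : K) (k : int) :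
  z != 0 -> k != 0 -> exists2 x, x != 0 & x ^ k = z.
Proof.
move=> z0 k0; have [x xE] : exists x, x ^+ `|k|%N = z.
  by apply: root_exists; rewrite absz_gt0.
have x0 : x != 0.
  by apply: contraNneq z0 => x0; rewrite -xE x0 expr0n absz_eq0 (negPf k0).
case: (intP k) k0 xE => // n' _ xE; first by exists x.
by exists x^-1; rewrite ?invr_eq0 // exprz_inv opprK.
Qed.

(** The image of a monomial map is cut out by the monomial equations that hold
    on it. The Smith normal form reduces this to a diagonal exponent matrix,
    where it amounts to extracting roots. *)
Lemma mexp_surj n r (C : 'M[int]_(n, r)) (u : 'I_n -> K) :
  (forall i, u i != 0) ->
  (forall a : 'rV[int]_n, a *m C = 0 -> mexp a u 0 = 1) ->
  exists2 t : 'I_r -> K, forall j, t j != 0 & mexp C t =1 u.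
Proof.
move=> u0 u1; have [L Lu [R Ru [d _ CE]]] := int_Smith_normal_form C.
set D := \matrix_(i, j) _ in CE; pose z := mexp (invmx L) u.
have z0 i : z i != 0 by apply: mexp_neq0.
have z1 i : row i D = 0 -> z i = 1.
  move=> Di; rewrite -(u1 (row i (invmx L))); last first.
    by rewrite -row_mul CE -mulmxA mulKmx // row_mul Di mul0mx.
  by apply: eq_bigr => j _; rewrite !mxE.
have [s s0 sE] : exists2 s : 'I_r -> K, forall j, s j != 0 & mexp D s =1 z.
  have sex (j : 'I_r) : exists2 x, x != 0 &
      forall i : 'I_n, i = j :> nat -> d`_i != 0 -> x ^ d`_i = z i.
    have [lt_jn|le_nj] := ltnP j n; last first.
      by exists 1 => [|i ij]; rewrite ?oner_neq0 // leqNgt -ij ltn_ord in le_nj *.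
    have [dj|dj] := eqVneq d`_j 0.
      by exists 1 => [|i ->]; rewrite ?oner_neq0 // dj.
    have [x x0 xE] := root_int_exists (z0 (Ordinal lt_jn)) dj.
    exists x => // i ij _; rewrite ij xE; congr (z _); exact: val_inj.
  pose s j := s2val (cid2 (sex j)).
  have sP (j : 'I_r) (i : 'I_n) : i = j :> nat -> d`_i != 0 -> s j ^ d`_i = z i.
    by move: i; apply: (s2valP' (cid2 (sex j))).
  exists s => [j|i]; first exact: (s2valP (cid2 (sex j))).
  have [/existsP[j /andP[/eqP ij di]]|/existsPn no_j] :=
      boolP [exists j : 'I_r, (i == j :> nat) && (d`_i != 0)].
    rewrite /mexp (bigD1 j) //= big1 => [|k kj].
      by rewrite mxE ij eqxx mulr1n mulr1 -ij sP.
    by rewrite !mxE ij eq_sym (inj_eq val_inj) (negPf kj) expr0z.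
  have Di j : D i j = 0.
    rewrite mxE; case: eqP => // ij; apply/eqP; have := no_j j.
    by rewrite ij eqxx /= negbK.
  rewrite z1; last by apply/rowP=> j; rewrite !mxE -[RHS](Di j) mxE.
  by apply: big1 => j _; rewrite Di expr0z.
pose t := mexp (invmx R) s; have t0 j : t j != 0 by apply: mexp_neq0.
exists t => // i; rewrite CE mexpM // mexpM; last by move=> j; apply: mexp_neq0.
have Rt : mexp R t =1 s by move=> j; rewrite -mexpM // mulmxV // mexp1.
rewrite (eq_mexp _ (eq_mexp _ Rt)) (eq_mexp _ sE) -mexpM // mulmxV //.
exact: mexp1.
Qed.

End MonomialMap.

Section WeightRelations.
Variables (K : closedFieldType) (r n : nat) (chi : 'I_n -> {ffun 'I_r -> int}).
Implicit Types (u v w : 'X_{1..n}) (t : {ffun 'I_r -> K}) (I : {set 'I_n}).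

Definition weight u : {ffun 'I_r -> int} := \sum_i chi i *+ u i.

Lemma weightD u v : weight (u + v)%MM = weight u + weight v.
Proof. by rewrite -big_split; apply: eq_bigr => i _; rewrite mnmDE mulrnDr. Qed.

Lemma weightMn u k : weight (u *+ k)%MM = weight u *+ k.
Proof. by rewrite -sumrMnl; apply: eq_bigr => i _; rewrite mulmnE mulrnA. Qed.

Definition relations : pred 'X_{1..n} := fun u => weight u == 0.

Lemma relations_saturated : saturated relations.
Proof.
rewrite /relations; split=> [|u v /eqP wu /eqP wv|u v /eqP wu /eqP wv le_vu|u k].
- by rewrite /weight big1 // => i _; rewrite mnm0E.
- by rewrite weightD wu wv addr0.
- by move: wu; rewrite -(submK le_vu) weightD wv addr0 submK // => ->.
- rewrite weightMn => /eqP/ffunP w0; apply/eqP/ffunP=> j.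
  have := w0 j; rewrite ffunMnE ffunE -mulr_natl => /eqP.
  by rewrite mulf_eq0 pnatr_eq0 => /eqP ->.
Qed.

Lemma tchar_weight t u : torus t -> tchar t (weight u) = \prod_i tchar t (chi i) ^+ u i.
Proof.
move=> Tt; rewrite (big_morph (tchar t) (fun a b => tcharD a b Tt) (tchar0 t)).
by apply: eq_bigr => i _; rewrite tcharMn.
Qed.

(** The orbits of the diagonal action, in multiplicative form: values z on the
    coordinates of I come from a point of the torus as soon as they satisfy all
    binomial equations between monomials of the same weight. *)
Lemma torus_image I (z : 'I_n -> K) : (forall i, i \in I -> z i != 0) ->
  (forall u v, esupp u \subset I -> esupp v \subset I -> weight u = weight v ->
     \prod_i z i ^+ u i = \prod_i z i ^+ v i) ->
  exists2 t, torus t & forall i, i \in I -> tchar t (chi i) = z i.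
Proof.
move=> z0 zE; pose z' i := if i \in I then z i else 1.
have z'0 i : z' i != 0 by rewrite /z'; case: ifP => [/z0//|_]; apply: oner_neq0.
pose C := \matrix_(i, j) (if i \in I then chi i j else 0).
(* An integral relation splits into its positive and negative parts; the
   coordinates outside I are neutralized by the value 1 and zero rows. *)
have [|t t0 tE] := @mexp_surj K n r C z' z'0.
  move=> a aC; pose b i := a 0 i; pose pos := [multinom (if i \in I then `|Num.max (b i) 0%R|%N else 0%N) | i < n].
  pose neg := [multinom (if i \in I then `|Num.max (- b i)%R 0%R|%N else 0%N) | i < n].
  have aE i : i \in I -> b i = (pos i)%:Z - (neg i)%:Z.
    move=> iI; rewrite !mnmE iI; lia.
  have sp : esupp pos \subset I.
    by apply/fintype.subsetP=> i; rewrite inE mnmE; case: ifP.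
  have sn : esupp neg \subset I.
    by apply/fintype.subsetP=> i; rewrite inE mnmE; case: ifP.
  have z'E u : esupp u \subset I -> \prod_i z i ^+ u i = \prod_i z' i ^+ u i.
    move=> su; apply: eq_bigr => i _; rewrite /z'; case: ifPn => // iI.
    suff -> : u i = 0%N by [].
    by apply/eqP; rewrite -[_ == _]negbK; apply: contra iI => ui;
       apply: (fintype.subsetP su); rewrite inE.
  have w_eq : weight pos = weight neg.
    apply/ffunP=> j; apply/eqP; rewrite -subr_eq0 !sum_ffunE -sumrB.
    move/matrixP/(_ 0 j): aC; rewrite !mxE => aC; rewrite -[X in _ == X]aC.
    apply/eqP/eq_bigr => i _; rewrite !ffunMnE mxE; case: ifP => iI.
      rewrite -/(b i) (aE i iI); move: (pos i) (neg i) (chi i j) => p q x.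
      by rewrite mulrBl -(mulr_natl x p) -(mulr_natl x q) !natz.
    by rewrite !mnmE iI mulr0 subrr.
  have := zE _ _ sp sn w_eq; rewrite !z'E // => eq_z.
  have nz : \prod_i z' i ^+ neg i != 0 by apply/prodf_neq0 => i _; rewrite expf_neq0.
  apply: (mulfI nz); rewrite mulr1 -[RHS]eq_z -big_split; apply: eq_bigr => i _ /=.
  have [iI|iI] := boolP (i \in I).
    by rewrite -/(b i) aE // expfzDr // -exprnN mulrCA divff ?mulr1 ?expf_neq0.
  by rewrite /z' (negPf iI) !expr1n exp1rz mulr1.
exists [ffun j => t j] => [j|i iI]; first by rewrite ffunE.
have := tE i; rewrite /z' iI => <-; apply: eq_bigr => j _.
by rewrite ffunE mxE iI.
Qed.

End WeightRelations.

(** * Linear substitutions and supports of vectors *)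

Section LinearSubstitution.
Variables (K : closedFieldType) (n : nat).
Implicit Types (p q : {mpoly K[n]}) (A B : 'M[K]_n) (y z : 'cV[K]_n)
  (u : 'X_{1..n}).

Lemma point_eval_inj p q : (forall y, point_eval p y = point_eval q y) -> p = q.
Proof.
move=> pq; apply/eqP; rewrite -subr_eq0; apply/eqP/mpoly_torus_eq0 => t _.
have := pq (\col_i t i); rewrite /point_eval => E.
by rewrite mevalB !(@meval_eq _ _ t (fun i => (\col_i t i) i 0)) ?E ?subrr // => i; rewrite mxE.
Qed.

Definition lin_subst A p : {mpoly K[n]} := p \mPo [tuple \sum_j A i j *: 'X_j | i < n].

HB.instance Definition _ A := GRing.RMorphism.copy (lin_subst A)
  (comp_mpoly [tuple \sum_j A i j *: 'X_j | i < n]).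
HB.instance Definition _ A := GRing.Linear.copy (lin_subst A)
  (comp_mpoly [tuple \sum_j A i j *: 'X_j | i < n]).

Lemma point_eval_lin A p y : point_eval (lin_subst A p) y = point_eval p (A *m y).
Proof.
rewrite /point_eval /lin_subst comp_mpoly_meval; apply: meval_eq => i.
rewrite tnth_mktuple mxE raddf_sum /=; apply: eq_bigr => j _.
by rewrite mevalZ mevalXU.
Qed.

Lemma lin_substK A B : A *m B = 1%:M -> cancel (lin_subst A) (lin_subst B).
Proof.
by move=> AB p; apply: point_eval_inj => y; rewrite !point_eval_lin mulmxA AB mul1mx.
Qed.

Definition vsupp y : {set 'I_n} := [set i | y i 0 != 0]%SET.

Definition vrestr (J : {set 'I_n}) y : 'cV[K]_n :=
  \col_i (if i \in J then y i 0 else 0).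

Lemma vsupp_restr J y : vsupp (vrestr J y) = J :&: vsupp y.
Proof. by apply/setP=> i; rewrite !inE mxE; case: ifP; rewrite ?eqxx. Qed.

Lemma point_evalX u y : point_eval 'X_[u] y = \prod_i y i 0 ^+ u i.
Proof. by rewrite /point_eval mevalX. Qed.

Lemma point_evalE p y :
  point_eval p y = \sum_(u <- msupp p) p@_u * \prod_i y i 0 ^+ u i.
Proof. by rewrite /point_eval mevalE. Qed.

Lemma monomial_neq0 u y : (\prod_i y i 0 ^+ u i != 0) = (esupp u \subset vsupp y).
Proof.
apply/prodf_neq0/fintype.subsetP => [y0 i|su i _].
  by rewrite !inE => ui; have := y0 i isT; rewrite expf_eq0 lt0n ui.
rewrite expf_eq0 negb_and -leqNgt leqn0.
by have := su i; rewrite !inE; case: eqVneq => //= _ /(_ isT) ->.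
Qed.

Lemma monomial_restr u J y :
  \prod_i vrestr J y i 0 ^+ u i = if esupp u \subset J then \prod_i y i 0 ^+ u i else 0.
Proof.
case: ifPn => [su|nsu].
  apply: eq_bigr => i _; rewrite mxE; case: ifPn => // iJ.
  suff -> : u i = 0%N by [].
  apply/eqP; rewrite -[_ == _]negbK; apply: contra iJ => ui.
  by apply: (fintype.subsetP su); rewrite inE.
apply/eqP; rewrite -[_ == _]negbK monomial_neq0 vsupp_restr.
by apply: contra nsu => /fintype.subset_trans; apply; apply: finset.subsetIl.
Qed.

End LinearSubstitution.

Section WeightDecomposition.
Variables (K : closedFieldType) (r n : nat) (chi : 'I_n -> {ffun 'I_r -> int}).
Implicit Types (u v w : 'X_{1..n}) (t : {ffun 'I_r -> K}) (y : 'cV[K]_n).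
Local Notation weight := (weight chi).
Local Notation M := (relations chi).

Definition act t y : 'cV[K]_n := \col_i (tchar t (chi i) * y i 0).

Lemma act_monomial t y u : torus t ->
  \prod_i act t y i 0 ^+ u i = tchar t (weight u) * \prod_i y i 0 ^+ u i.
Proof.
move=> Tt; rewrite tchar_weight // -big_split; apply: eq_bigr => i _ /=.
by rewrite mxE exprMn.
Qed.

Lemma vsupp_act t y : torus t -> vsupp (act t y) = vsupp y.
Proof.
move=> Tt; apply/setP=> i.
by rewrite !inE mxE mulf_eq0 (negPf (tchar_neq0 _ Tt)).
Qed.

(** Linear independence of characters, in the form needed to split a vanishing
    sum into its homogeneous parts. Multiplying by a large power of the product
    of the coordinates turns Laurent polynomials into polynomials. *)
Section Classes.
Variable s : seq 'X_{1..n}.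
Let N : nat := \sum_(u <- s) \sum_j `|weight u j|%N.
Let shifted u : 'X_{1..r} := [multinom `|(weight u j + N%:Z)%R|%N | j < r].
Let laurent (c : 'X_{1..n} -> K) : {mpoly K[r]} := \sum_(u <- s) c u *: 'X_[shifted u].

Let shiftedE u j : u \in s -> (shifted u j)%:Z = weight u j + N%:Z.
Proof.
move=> us; rewrite mnmE; suff : (`|weight u j| <= N)%N by lia.
by rewrite /N (big_rem u) //= (bigD1 j) //= -addnA leq_addr.
Qed.

Let shifted_eq u v : u \in s -> v \in s -> (shifted u == shifted v) = (weight u == weight v).
Proof.
move=> us vs; apply/eqP/eqP => [suv|wuv]; last by rewrite /shifted wuv.
apply/ffunP=> j; apply: (@addIr _ N%:Z).
by rewrite -!shiftedE // suv.
Qed.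

Let laurent_coef c w : w \in s ->
  (laurent c)@_(shifted w) = \sum_(u <- s | weight u == weight w) c u.
Proof.
move=> ws; rewrite /laurent raddf_sum /= [RHS]big_mkcond /=.
rewrite [LHS]big_seq [RHS]big_seq; apply: eq_bigr => u us.
by rewrite mcoeffZ mcoeffX shifted_eq //; case: eqP; rewrite ?mulr1 ?mulr0.
Qed.

Let laurent_eval c t : torus t ->
  (laurent c).@[t] = (\prod_j t j) ^+ N * \sum_(u <- s) c u * tchar t (weight u).
Proof.
move=> Tt; rewrite raddf_sum /= mulr_sumr big_seq [RHS]big_seq.
apply: eq_bigr => u us; rewrite mevalZ mevalX mulrCA; congr (_ * _).
rewrite -prodrXl -big_split; apply: eq_bigr => j _ /=.
by rewrite !exprnP -expfzDr ?Tt // shiftedE // addrC.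
Qed.

Lemma weight_class_eq0 (c : 'X_{1..n} -> K) :
  (forall t, torus t -> \sum_(u <- s) c u * tchar t (weight u) = 0) ->
  forall w, w \in s -> \sum_(u <- s | weight u == weight w) c u = 0.
Proof.
move=> c0 w ws; rewrite -laurent_coef // (_ : laurent c = 0) ?mcoeff0 //.
by apply: mpoly_torus_eq0 => t Tt; rewrite laurent_eval // c0 // mulr0.
Qed.

Lemma weight_class_sum0 (c : 'X_{1..n} -> K) :
  (forall w, w \in s -> \sum_(u <- s | weight u == weight w) c u = 0) ->
  \sum_(u <- s) c u = 0.
Proof.
move=> c0; have L0 : laurent c = 0.
  apply/mpolyP=> m; rewrite mcoeff0.
  have [/hasP[w ws /eqP <-]|/hasPn nm] := boolP (has (fun w => shifted w == m) s).
    by rewrite laurent_coef ?c0.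
  rewrite /laurent raddf_sum /= big_seq big1 // => u us.
  by rewrite mcoeffZ mcoeffX (negPf (nm u us)) mulr0.
have T1 : torus ([ffun => 1] : {ffun 'I_r -> K}) by move=> j; rewrite ffunE oner_neq0.
have := laurent_eval c T1; rewrite L0 meval0.
rewrite big1 => [|j _]; last by rewrite ffunE.
rewrite expr1n mul1r => E; rewrite [RHS]E; apply: eq_bigr => u _.
by rewrite /tchar big1 ?mulr1 // => j _; rewrite ffunE exp1rz.
Qed.

End Classes.

(** Splitting g into weight components, each of them vanishes at y. At the
    truncation of y to J only the monomials supported in J survive. If, in every
    component that contains such a monomial, all the monomials that do not
    vanish at y were supported in J, then g would vanish there as well. *)
Lemma vanishing_relation (g : {mpoly K[n]}) y (J : {set 'I_n}) :
  (forall t, torus t -> point_eval g (act t y) = 0) ->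
  point_eval g (vrestr J y) != 0 ->
  exists u w, [/\ esupp u \subset J, esupp w \subset vsupp y,
    ~~ (esupp w \subset J) & weight u = weight w].
Proof.
move=> g0 gJ; apply: contrapT => no_uw.
pose c u := g@_u * \prod_i y i 0 ^+ u i.
pose cJ u := if esupp u \subset J then c u else 0.
have class0 : forall w, w \in msupp g ->
    \sum_(u <- msupp g | weight u == weight w) c u = 0.
  apply: weight_class_eq0 => t Tt; rewrite -[RHS](g0 t Tt) point_evalE.
  by apply: eq_bigr => u _; rewrite act_monomial // mulrCA mulrC mulrA.
case/negP: gJ; apply/eqP; rewrite point_evalE.
transitivity (\sum_(u <- msupp g) cJ u).
  apply: eq_bigr => u _; rewrite monomial_restr /cJ; case: ifP => // _.
  by rewrite mulr0.
apply: weight_class_sum0 => w wg.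
have [/hasP[u ug /and3P[wuw suJ cu]]|/hasPn no_u] := boolP (has
    (fun u => [&& weight u == weight w, esupp u \subset J & c u != 0]) (msupp g)).
  rewrite -[RHS](class0 w wg); apply: eq_bigr => v /eqP wvw.
  rewrite /cJ; case: ifPn => // nvJ; apply/esym/eqP; rewrite -[_ == _]negbK.
  apply/negP; rewrite mulf_eq0 negb_or monomial_neq0 => /andP[_ sv].
  by apply: no_uw; exists u, v; split=> //; rewrite wvw (eqP wuw).
rewrite big_seq_cond big1 // => u /andP[ug wuw]; rewrite /cJ; case: ifP => // suJ.
by apply/eqP; have := no_u u ug; rewrite wuw suJ negbK.
Qed.

(** w1 - u1 is an integral relation which is nonnegative outside the support of
    u; a large multiple of u makes it nonnegative everywhere. *)
Lemma relations_extend u u1 w1 : M u -> esupp u1 \subset esupp u ->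
  weight u1 = weight w1 -> exists2 u', M u' & esupp u' = esupp u :|: esupp w1.
Proof.
move=> /eqP Mu su wuw; pose k := (mdeg u1).+1; pose a := (w1 + u *+ k)%MM.
have lt_u1 i : (u1 i < k)%N by rewrite ltnS mdegE (bigD1 i) //= leq_addr.
have su1 i : u i = 0%N -> u1 i = 0%N.
  move=> ui; apply/eqP; rewrite -[_ == _]negbK; apply/negP => u1i.
  by have := fintype.subsetP su i; rewrite !inE u1i ui => /(_ isT).
have le_ua : (u1 <= a)%MM.
  apply/mnm_lepP=> i; rewrite mnmDE mulmnE; have := lt_u1 i.
  have [/su1->//|] := posnP (u i); nia.
exists (a - u1)%MM.
  apply/eqP/(@addIr _ (weight u1)).
  by rewrite -weightD submK // weightD weightMn Mu mul0rn addr0 add0r wuw.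
apply/setP=> i; rewrite !inE mnmBE mnmDE mulmnE; have := lt_u1 i.
have [ui|] := posnP (u i); first by rewrite ui su1 //= mul0n addn0 subn0.
by rewrite orTb; nia.
Qed.

End WeightDecomposition.

(** * Linear maps on polynomials given on monomials *)

Section MonomialBasis.
Variables (R : comNzRingType) (n : nat) (W : lmodType R) (F : 'X_{1..n} -> W).

Definition mextend (h : {mpoly R[n]}) : W := \sum_(w <- msupp h) h@_w *: F w.

Lemma mextendE (s : seq 'X_{1..n}) h : uniq s -> {subset msupp h <= s} ->
  mextend h = \sum_(w <- s) h@_w *: F w.
Proof.
move=> us sub; rewrite (bigID (mem (msupp h))) /= [X in _ + X]big1 ?addr0; last first.
  by move=> w /memN_msupp_eq0->; rewrite scale0r.
rewrite -big_filter; apply: perm_big; apply: uniq_perm; rewrite ?msupp_uniq ?filter_uniq //.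
move=> w; rewrite mem_filter /=; apply/idP/andP => [wh|[]//].
by split=> //; apply: sub.
Qed.

Lemma mextend_linear : linear mextend.
Proof.
move=> a p q; pose s := undup (msupp (a *: p + q) ++ msupp p ++ msupp q).
have us : uniq s by apply: undup_uniq.
rewrite !(@mextendE s) //; first last.
- by move=> w; rewrite mem_undup !mem_cat => ->.
- by move=> w; rewrite mem_undup !mem_cat => ->; rewrite orbT.
- by move=> w; rewrite mem_undup !mem_cat => ->; rewrite !orbT.
rewrite scaler_sumr -big_split; apply: eq_bigr => w _ /=.
by rewrite mcoeffD mcoeffZ scalerDl scalerA.
Qed.

HB.instance Definition _ := GRing.isLinear.Build R {mpoly R[n]} W _ mextend mextend_linear.

Lemma mextendX u : mextend 'X_[u] = F u.
Proof. by rewrite /mextend msuppX big_seq1 mcoeffX eqxx scale1r. Qed.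

End MonomialBasis.

Lemma linear_mpoly_eq (R : comNzRingType) n (W : lmodType R)
    (f g : {linear {mpoly R[n]} -> W}) :
  (forall u, f 'X_[u] = g 'X_[u]) -> f =1 g.
Proof.
move=> fg p; rewrite [p]mpolyE !linear_sum; apply: eq_bigr => u _.
by rewrite !linearZ /= fg.
Qed.

(** The functional reading the coefficient of s in p * q, recovered from its
    values at the monomials q. *)
Lemma mextend_coefM (R : comNzRingType) n (p q : {mpoly R[n]}) s :
  mextend (fun w => (p * 'X_[w])@_s : R^o) q = (p * q)@_s.
Proof.
rewrite [q in RHS]mpolyE mulr_sumr raddf_sum; apply: eq_bigr => w _.
by rewrite -[in RHS]scalerAr /= mcoeffZ.
Qed.

Lemma mextend_funD (R : comNzRingType) n (W : lmodType R) (F G : 'X_{1..n} -> W) p :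
  mextend (fun w => F w + G w) p = mextend F p + mextend G p.
Proof. by rewrite -big_split; apply: eq_bigr => w _; rewrite scalerDr. Qed.

Section Dual.
Variables (R : comNzRingType) (n : nat) (A : comNzRingType).

(** The R-linear dual of the polynomial ring, as an A-module through g: a linear
    form is encoded by its values at the monomials. *)
Definition dual_mod (g : {rmorphism A -> {mpoly R[n]}}) := 'X_{1..n} -> R^o.

Variable g : {rmorphism A -> {mpoly R[n]}}.

HB.instance Definition _ := GRing.Zmodule.copy (dual_mod g) ('X_{1..n} -> R^o).

Definition dual_scale (a : A) (psi : dual_mod g) : dual_mod g :=
  fun w => mextend psi (g a * 'X_[w]).

Lemma mextend_dual_scale a psi p :
  mextend (dual_scale a psi) p = mextend psi (g a * p).
Proof.
rewrite [p in RHS]mpolyE mulr_sumr linear_sum; apply: eq_bigr => w _.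
by rewrite -scalerAr linearZ.
Qed.

Fact dual_scaleA a b psi : dual_scale a (dual_scale b psi) = dual_scale (a * b) psi.
Proof. by apply: funext => w; rewrite {1}/dual_scale mextend_dual_scale mulrA -rmorphM [b * a]mulrC. Qed.
Fact dual_scale1 : left_id 1 dual_scale.
Proof. by move=> psi; apply: funext => w; rewrite /dual_scale rmorph1 mul1r mextendX. Qed.
Fact dual_scaleDr : right_distributive dual_scale +%R.
Proof. by move=> a psi psi'; apply: funext => w; rewrite /dual_scale mextend_funD. Qed.
Fact dual_scaleDl psi : {morph dual_scale^~ psi : a b / a + b}.
Proof. by move=> a b; apply: funext => w; rewrite /dual_scale rmorphD mulrDl linearD. Qed.

HB.instance Definition _ := GRing.Zmodule_isLmodule.Build A (dual_mod g)
  dual_scaleA dual_scale1 dual_scaleDr dual_scaleDl.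
End Dual.

(** * Smoothness of polynomial algebras *)

Section EvalAlg.
Variables (K : fieldType) (d : nat) (B : comAlgType K) (h : 'I_d -> B).

Definition meval_alg : {mpoly K[d]} -> B := mmap (in_alg B) h.

HB.instance Definition _ := GRing.RMorphism.copy meval_alg (mmap (in_alg B) h).

Fact meval_alg_scalable : scalable meval_alg.
Proof. by move=> c p; rewrite /meval_alg mmapZ /= mulr_algl. Qed.

HB.instance Definition _ := GRing.isScalable.Build K {mpoly K[d]} B _ meval_alg meval_alg_scalable.

Lemma meval_algX u : meval_alg 'X_[u] = \prod_i h i ^+ u i.
Proof. by rewrite /meval_alg mmapX. Qed.

End EvalAlg.

Lemma lrmorphism_monomial (K : fieldType) d (B : comAlgType K)
    (f : {lrmorphism {mpoly K[d]} -> B}) u : f 'X_[u] = \prod_i f 'X_i ^+ u i.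
Proof.
by rewrite mpolyXE_id rmorph_prod; apply: eq_bigr => i _; rewrite rmorphXn.
Qed.

(** A morphism out of a polynomial ring is lifted by lifting the images of the
    variables. *)
Lemma mpoly_formally_smooth (K : fieldType) d : formally_smooth {mpoly K[d]}.
Proof.
move=> B C q q_surj _ f.
pose b (i : 'I_d) := sval (cid (q_surj (f 'X_i))).
have bE i : q (b i) = f 'X_i by apply: (svalP (cid (q_surj (f 'X_i)))).
exists (meval_alg b : {lrmorphism {mpoly K[d]} -> B}) => p.
move: p; apply: (@linear_mpoly_eq _ _ _ (q \o meval_alg b) f) => u /=.
rewrite meval_algX rmorph_prod lrmorphism_monomial.
by apply: eq_bigr => i _; rewrite rmorphXn /= bE.
Qed.

Section InverseMorphism.
Variables (K : fieldType) (A B : comAlgType K) (q : {lrmorphism A -> B}).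
Variables (q' : B -> A) (qK : cancel q q') (q'K : cancel q' q).

Definition inverse_morphism of (cancel q q') & (cancel q' q) := q'.
Local Notation g := (inverse_morphism qK q'K).

HB.instance Definition _ := GRing.isLinear.Build K B A _ g (can2_linear qK q'K).
HB.instance Definition _ := GRing.isMonoidMorphism.Build B A g (can2_monoid_morphism qK q'K).

End InverseMorphism.

Lemma formally_smooth_iso (K : fieldType) (A B : comAlgType K) (q : {lrmorphism A -> B}) :
  bijective q -> formally_smooth A -> formally_smooth B.
Proof.
move=> [q' qK q'K] smA B' C p p_surj p_sq f.
have [g gE] := smA B' C p p_surj p_sq (f \o q : {lrmorphism A -> C}).
exists (g \o inverse_morphism qK q'K : {lrmorphism B -> B'}) => b /=.
by rewrite gE /= /inverse_morphism q'K.
Qed.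

(** * Irreducible sets for the Zariski topology *)

Local Open Scope classical_set_scope.

(** These facts only use that the functions of F can be multiplied, so they
    apply both to V and to the quotient. *)
Section ZariskiFacts.
Variables (K : fieldType) (F X : Type) (ev : F -> X -> K).
Variables (one : F) (mul : F -> F -> F).
Hypothesis ev1 : forall x, ev one x = 1.
Hypothesis evM : forall f g x, ev (mul f g) x = ev f x * ev g x.

Lemma zclosed0 : zclosed ev set0.
Proof.
exists [set one]; apply/seteqP; split=> // x /= /(_ one erefl) /eqP.
by rewrite ev1 oner_eq0.
Qed.

Lemma zclosedU C D : zclosed ev C -> zclosed ev D -> zclosed ev (C `|` D).
Proof.
move=> [S ->] [T ->]; exists [set h | exists f g, [/\ S f, T g & h = mul f g]].
apply/seteqP; split=> [x [Sx|Tx] _ [f [g [Sf Tg ->]]]|x ST].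
- by rewrite evM (Sx f Sf) mul0r.
- by rewrite evM (Tx g Tg) mulr0.
have [Sx|/existsNP[f /not_implyP[Sf fx]]] := pselect (zlocus ev S x); first by left.
right=> g Tg; have /eqP := ST (mul f g) (ex_intro _ f (ex_intro _ g (And3 Sf Tg erefl))).
by rewrite evM mulf_eq0 => /orP[/eqP//|/eqP].
Qed.

Lemma zirreducible_union (I : eqType) (s : seq I) (C : I -> set X) Y :
  zirreducible ev Y -> (forall i, zclosed ev (C i)) ->
  Y `<=` [set x | exists2 i, i \in s & C i x] -> exists2 i, i \in s & Y `<=` C i.
Proof.
move=> [Y0 irrY] clC; elim: s => [|i s IHs] sub.
  by have [y Yy] := Y0; have [] := sub y Yy.
have clD : zclosed ev [set x | exists2 j, j \in s & C j x].
  elim: s {IHs sub} => [|j s IHs].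
    rewrite (_ : [set _ | _] = set0); first exact: zclosed0.
    by apply/seteqP; split=> // x [].
  rewrite (_ : [set _ | _] = C j `|` [set x | exists2 j, j \in s & C j x]).
    exact: zclosedU.
  apply/seteqP; split=> x /=.
    by case=> k; rewrite inE => /orP[/eqP->|ks]; [left|right; exists k].
  by case=> [Cx|[k ks Cx]]; [exists j|exists k]; rewrite ?inE ?eqxx ?ks ?orbT.
have [|sC|/IHs[j js sC]] := irrY _ _ (clC i) clD.
- move=> x /sub[k]; rewrite inE => /orP[/eqP->|ks]; [by left|by right; exists k].
- by exists i => //; rewrite inE eqxx.
- by exists j => //; rewrite inE js orbT.
Qed.

End ZariskiFacts.

Section AffineIrreducible.
Variables (K : closedFieldType) (n : nat).

Lemma line_restriction (f : {mpoly K[n]}) (v w : 'cV[K]_n) :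
  exists F : {poly K}, forall s, F.[s] = point_eval f (v + s *: w).
Proof.
exists (mmap (@polyC K) (fun i => (v i 0)%:P + w i 0 *: 'X) f) => s.
rewrite /mmap horner_sum point_evalE; apply: eq_bigr => u _.
rewrite hornerM hornerC /mmap1 horner_prod; congr (_ * _); apply: eq_bigr => i _.
by rewrite horner_exp !hornerE !mxE mulrC.
Qed.

(** Two polynomials that are nonzero at v and at w respectively have a common
    nonzero value on the line through v and w. *)
Lemma line_closed_irreducible (Y : set 'cV[K]_n) : Y !=set0 ->
  (forall v w s, Y v -> Y w -> Y (v + s *: (w - v))) ->
  zirreducible (@point_eval K n) Y.
Proof.
move=> Y0 lineY; split=> // _ _ [S ->] [T ->] sub.
apply: contrapT => /not_orP[] /existsNP[v /not_implyP[Yv /existsNP[f /not_implyP[Sf fv]]]].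
move=> /existsNP[w /not_implyP[Yw /existsNP[g /not_implyP[Tg gw]]]].
have [F FE] := line_restriction f v (w - v).
have [G GE] := line_restriction g v (w - v).
have F0 : F != 0.
  by apply: contra_notN fv => /eqP F0; rewrite -[v]addr0 -(scale0r (w - v)) -FE F0 horner0.
have G0 : G != 0.
  apply: contra_notN gw => /eqP G0.
  by rewrite -[w](subrKC v) -[w - v]scale1r -GE G0 horner0.
have /closed_nonrootP[s] : F * G != 0 by rewrite mulf_neq0.
rewrite rootM negb_or => /andP[/negP Fs /negP Gs].
case: (sub _ (lineY v w s Yv Yw)) => [/(_ f Sf)|/(_ g Tg)].
  by rewrite -FE => /eqP.
by rewrite -GE => /eqP.
Qed.

End AffineIrreducible.

Section DiagonalizedRepresentation.
Variables (K : closedFieldType) (r n : nat) (V : torus_rep K r n).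
Hypothesis hK : [pchar K]%R =i pred0.
Variables (P : 'M[K]_n) (chi : 'I_n -> {ffun 'I_r -> int}).
Hypothesis Pu : P \in unitmx.
Hypothesis VE : forall t, torus t ->
  V t = P *m diag_mx (\row_i tchar t (chi i)) *m invmx P.
Implicit Types (t : {ffun 'I_r -> K}) (i c : 'I_n) (J : {set 'I_n}).
Local Notation M := (relations chi).
(* inP p is p written in the diagonalizing coordinates y, where v = P y. *)
Local Notation inP := (lin_subst P).
Local Notation ofP := (lin_subst (invmx P)).
Local Notation coords v := (invmx P *m v).
Local Notation ev := (@point_eval K n).
Local Notation qev := (@quotient_eval K r n V).
Local Notation pi := (@quotient_map K r n V).

Let satM : saturated M := relations_saturated chi.

(** * Stable vectors *)

Section StableVectors.
Implicit Types (y z v : 'cV[K]_n) (f : {mpoly K[n]}).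

Lemma rep_act t y : torus t -> V t *m (P *m y) = P *m act chi t y.
Proof.
move=> Tt; rewrite VE // -!mulmxA mulKmx //; congr (_ *m _).
by apply/colP=> i; rewrite mul_diag_mx !mxE.
Qed.

Lemma coordsK y : P *m (invmx P *m y) = y. Proof. exact: mulKVmx. Qed.

Lemma torus1 : torus ([ffun => 1] : {ffun 'I_r -> K}).
Proof. by move=> j; rewrite ffunE oner_neq0. Qed.

Lemma orbit_refl v : orbit V v v.
Proof. by exists [ffun => 1]; [apply: torus1 | rewrite rep_mx1 mul1mx]. Qed.

Lemma orbit_act t y : torus t -> orbit V (P *m y) (P *m act chi t y).
Proof. by move=> Tt; exists t => //; rewrite rep_act. Qed.

Lemma orbitP y v : orbit V (P *m y) v -> exists2 t, torus t & v = P *m act chi t y.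
Proof. by case=> t Tt <-; exists t => //; rewrite rep_act. Qed.

Lemma orbit_vsupp y z : orbit V (P *m y) (P *m z) -> vsupp z = vsupp y.
Proof.
by move=> /orbitP[t Tt /(can_inj (mulKmx Pu)) ->]; rewrite vsupp_act.
Qed.

Lemma orbit_trans (v w : 'cV[K]_n) : orbit V v w -> orbit V v = orbit V w.
Proof.
case=> t Tt <-; apply/seteqP; split=> _ [s Ts <-].
  exists [ffun j => s j / t j]; first by move=> j; rewrite ffunE mulf_neq0 ?invr_neq0 ?Ts ?Tt.
  rewrite mulmxA -rep_mxM //; last first.
    by move=> j; rewrite ffunE mulf_neq0 ?invr_neq0 ?Ts ?Tt.
  by congr (V _ *m _); apply/ffunP=> j; rewrite !ffunE divfK ?Tt.
exists [ffun j => s j * t j]; first by move=> j; rewrite ffunE mulf_neq0 ?Ts ?Tt.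
by rewrite rep_mxM // mulmxA.
Qed.

Lemma separated_relation f y J :
  (forall x, orbit V (P *m y) x -> point_eval f x = 0) ->
  point_eval f (P *m vrestr J y) != 0 ->
  exists u w, [/\ esupp u \subset J, esupp w \subset vsupp y,
    ~~ (esupp w \subset J) & weight chi u = weight chi w].
Proof.
move=> f0 fJ; apply: (@vanishing_relation _ _ _ chi (inP f)).
  by move=> t Tt; rewrite point_eval_lin f0 //; apply: orbit_act.
by rewrite point_eval_lin.
Qed.

Lemma zclosed_separate (C : set 'cV[K]_n) x : zclosed (@point_eval K n) C ->
  ~ C x -> exists f, (forall z, C z -> point_eval f z = 0) /\ point_eval f x != 0.
Proof.
move=> [S ->] nSx; apply: contrapT => no_f; apply: nSx => f Sf.
by apply/eqP; apply: contra_notT no_f => fx; exists f; split=> // z; apply.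
Qed.

(** Take u in M of largest support inside the support of y. If some coordinate
    of y were missed, then the truncation of y to the support of u would not be
    in the closed orbit, and the relation produced by an equation separating
    them would extend the support of u. *)
Lemma closed_orbit_support y : zclosed (@point_eval K n) (orbit V (P *m y)) ->
  exists2 u, M u & esupp u = vsupp y.
Proof.
move=> clO; pose Q k := `[< exists u, [/\ M u, esupp u \subset vsupp y & #|esupp u| = k] >].
have exQ : exists k, Q k.
  exists 0%N; apply/asboolP; exists 0%MM; rewrite esupp0 finset.sub0set cards0.
  by split=> //; apply: sat0 satM.
have [k|k /asboolP[u [Mu su <-]] max_u] := ex_maxnP exQ (m := n).
  by move=> /asboolP[u [_ _ <-]]; rewrite -[X in (_ <= X)%N]card_ord max_card.
have [suy|nsu] := eqVneq (esupp u) (vsupp y); first by exists u.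
have [|f [f0 fu]] := @zclosed_separate _ (P *m vrestr (esupp u) y) clO.
  move/orbit_vsupp; rewrite vsupp_restr => E; case/eqP: nsu; rewrite -E.
  by apply/esym/finset.setIidPl.
have [u1 [w [su1 sw nsw wuw]]] := separated_relation f0 fu.
have [u' Mu' su'] := relations_extend Mu su1 wuw.
have /max_u : Q #|esupp u'|.
  by apply/asboolP; exists u'; split=> //; rewrite su' finset.subUset su sw.
rewrite leqNgt => /negP[]; apply: proper_card; rewrite su' finset.properEneq finset.subsetUl andbT.
by apply: contraNneq nsw => ->; apply: finset.subsetUr.
Qed.

(** For j outside the support of y, let y' be y with its j-th coordinate set to
    1. Stability separates y from the orbit of y', and y is a truncation of
    y', so some relation has j in its support. *)
Lemma stable_spanning y : stable_vector V (P *m y) -> spanning M (vsupp y).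
Proof.
move=> [clO stO] j; have [u Mu su] := closed_orbit_support clO.
have [yj|yj] := eqVneq (y j 0) 0; last first.
  by exists u => //; rewrite su; apply/esym/finset.setUidPr; rewrite finset.sub1set inE.
pose y' : 'cV[K]_n := \col_i (if i == j then 1 else y i 0).
have sy' : vsupp y' = j |: vsupp y.
  by apply/setP=> i; rewrite !inE mxE; case: (eqVneq i j); rewrite ?oner_neq0.
have yE : y = vrestr (vsupp y) y'.
  apply/colP=> i; rewrite !mxE inE; case: eqVneq => [->//|yi].
  by case: (eqVneq i j) yi => // ->; rewrite yj eqxx.
have /stO : orbit V (P *m y') <> orbit V (P *m y).
  move=> E; have := orbit_refl (P *m y'); rewrite E => /orbit_vsupp.
  by rewrite sy' => /setP/(_ j); rewrite !inE eqxx yj eqxx.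
rewrite /zclosure /= => /existsNP[C] /not_implyP[clC] /not_implyP[sC nC].
have [f [f0 fy]] := zclosed_separate clC nC.
have [||u1 [w [su1 sw nsw wuw]]] := @separated_relation f y' (vsupp y).
- by move=> x /sC/f0.
- by rewrite -yE.
rewrite -su in su1; have [u' Mu' su'] := relations_extend Mu su1 wuw.
exists u' => //; rewrite su' su; apply/eqP; rewrite finset.eqEsubset !finset.subUset.
rewrite finset.subsetUr finset.subsetUl -sy' sw /= andbT finset.sub1set inE.
apply/orP; right; have /subsetPn[i iw iy] := nsw.
have := fintype.subsetP sw i iw; rewrite sy' !inE; rewrite inE in iy.
case/orP=> [/eqP ij|yi]; last by rewrite yi in iy.
by move: iw; rewrite ij inE.
Qed.

(** The orbit is the zero locus of its ideal: the binomials y^b X^a - y^a X^b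
    with a, b of the same weight determine the torus orbit of a point, and the
    equation given by u prevents coordinates of the support from vanishing. *)
Lemma support_closed_orbit y u : M u -> esupp u = vsupp y ->
  zclosed (@point_eval K n) (orbit V (P *m y)).
Proof.
move=> Mu su.
exists [set f | forall x, orbit V (P *m y) x -> point_eval f x = 0]%classic.
apply/seteqP; split=> [x Ox f /(_ x Ox) //|x /= x0].
pose z := invmx P *m x; have xE : x = P *m z by rewrite coordsK.
have z0 (q : {mpoly K[n]}) : (forall t, torus t -> point_eval q (act chi t y) = 0) ->
    point_eval q z = 0.
  move=> q0; rewrite -(point_eval_lin (invmx P)); apply: x0.
  by move=> _ /orbitP[t Tt ->]; rewrite point_eval_lin mulKmx // q0.
have rel_z a b : weight chi a = weight chi b ->
    \prod_i z i 0 ^+ a i * \prod_i y i 0 ^+ b i =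
    \prod_i z i 0 ^+ b i * \prod_i y i 0 ^+ a i.
  move=> wab; have /z0 : forall t, torus t ->
      point_eval ((\prod_i y i 0 ^+ b i) *: 'X_[a] - (\prod_i y i 0 ^+ a i) *: 'X_[b])
        (act chi t y) = 0.
    move=> t Tt; rewrite /point_eval mevalB !mevalZ -!/(point_eval _ _) !point_evalX.
    by rewrite !act_monomial // wab; ring.
  rewrite /point_eval mevalB !mevalZ -!/(point_eval _ _) !point_evalX => /eqP.
  by rewrite subr_eq0 => /eqP E; rewrite mulrC E mulrC.
have sz : vsupp z = vsupp y.
  apply/eqP; rewrite finset.eqEsubset; apply/andP; split.
    apply/fintype.subsetP=> i; rewrite !inE; apply: contraNneq => yi.
    have /z0 : forall t, torus t -> point_eval 'X_i (act chi t y) = 0.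
      by move=> t _; rewrite /point_eval mevalXU mxE yi mulr0.
    by rewrite /point_eval mevalXU => /eqP.
  rewrite -su -monomial_neq0.
  have := rel_z u 0%MM; rewrite (eqP Mu).
  have w0 : weight chi 0%MM = 0 by apply/eqP; apply: sat0 satM.
  rewrite w0 => /(_ erefl).
  have m0 (y' : 'cV[K]_n) : \prod_i y' i 0 ^+ (0%MM : 'X_{1..n}) i = 1.
    by rewrite big1 // => i _; rewrite mnm0E.
  by rewrite !m0 mulr1 mul1r => ->; rewrite monomial_neq0 su.
have y0 i : i \in vsupp y -> y i 0 != 0 by rewrite inE.
have [| |t Tt tE] := @torus_image K r n chi (vsupp y) (fun i => z i 0 / y i 0).
- by move=> i iy; rewrite mulf_neq0 ?invr_neq0 ?y0 //; rewrite -sz inE in iy.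
- move=> a b sa sb wab.
  have divE (c : 'X_{1..n}) : \prod_i (z i 0 / y i 0) ^+ c i =
      (\prod_i z i 0 ^+ c i) / \prod_i y i 0 ^+ c i.
    by rewrite -prodf_div; apply: eq_bigr => i _; rewrite exprMn exprVn.
  rewrite !divE; apply/eqP; rewrite eqr_div ?monomial_neq0 //; apply/eqP.
  exact: rel_z.
rewrite xE (_ : z = act chi t y); first exact: orbit_act.
apply/colP=> i; rewrite [RHS]mxE; have [yi|yi] := boolP (i \in vsupp y).
  by rewrite tE // divfK ?y0.
have : i \notin vsupp z by rewrite sz.
by move: yi; rewrite !inE !negbK => /eqP-> /eqP->; rewrite mulr0.
Qed.

(** Supports can only shrink in an orbit closure, so an orbit whose closure
    contains P y has a larger, hence spanning, support; that orbit is
    closed. *)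
Lemma spanning_stable y : spanning M (vsupp y) -> stable_vector V (P *m y).
Proof.
move=> spy; split.
  by have [u Mu su] := spanning_supp satM spy; apply: support_closed_orbit su.
move=> w Ow clw; apply: (Ow); pose z := invmx P *m w.
have wE : w = P *m z by rewrite coordsK.
rewrite wE in Ow clw *.
have syz : vsupp y \subset vsupp z.
  apply/fintype.subsetP=> i; rewrite !inE; apply: contraNneq => zi.
  have := clw [set x | point_eval (lin_subst (invmx P) 'X_i) x = 0]%classic.
  rewrite /= point_eval_lin mulKmx // /point_eval mevalXU => -> //.
    exists [set lin_subst (invmx P) 'X_i]%classic; apply/seteqP; split=> x /=.
      by move=> x0 _ ->.
    by apply.
  move=> _ /orbitP[t Tt ->]; rewrite /= -/(point_eval _ _) point_eval_lin mulKmx //.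
  by rewrite /point_eval mevalXU mxE zi mulr0.
have [u Mu su] := spanning_supp satM (spanning_sub satM syz spy).
have /orbit_trans// : orbit V (P *m z) (P *m y).
by apply: clw => //; apply: support_closed_orbit su.
Qed.

Lemma stable_vectorP v : stable_vector V v <-> spanning M (vsupp (invmx P *m v)).
Proof.
split=> [|/spanning_stable]; last by rewrite coordsK.
by rewrite -{1}(coordsK v); apply: stable_spanning.
Qed.

End StableVectors.

(** * The invariant ring *)

Section InvariantRing.
Implicit Types (u v w : 'X_{1..n}) (a : inv_ring V) (y : 'cV[K]_n) (f : {mpoly K[n]}).

Lemma inPK : cancel inP ofP.
Proof. by apply: lin_substK; rewrite mulmxV. Qed.

Lemma ofPK : cancel ofP inP.
Proof. by apply: lin_substK; rewrite mulVmx. Qed.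

(** In characteristic zero 2 has infinite order, so characters separate
    weights. *)
Lemma exp2z_eq1 (k : int) : (2%:R : K) ^ k = 1 -> k = 0.
Proof.
have nat0 : forall m, (m%:R == 0 :> K) = (m == 0)%N by apply/pcharf0P.
have pow m : (2%:R : K) ^+ m = 1 -> m = 0%N.
  move/eqP; rewrite -natrX -subr_eq0 -(natrB _ (expn_gt0 2 m)) nat0 subn_eq0.
  by case: m => // m; rewrite leqNgt -[1%N]/(2 ^ 0)%N ltn_exp2l.
case: (intP k) => // m; first by move/pow.
rewrite -exprnN => /eqP; rewrite invr_eq1 => /eqP/pow //.
Qed.

Lemma weight_eq0_char u : (forall t, torus t -> tchar t (weight chi u) = 1) -> M u.
Proof.
move=> t1; apply/eqP/ffunP=> j; rewrite [RHS]ffunE.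
have nz2 : (2%:R : K) != 0 by move/pcharf0P: hK => ->.
pose t := [ffun i => if i == j then 2%:R else 1 : K].
have /t1 : torus t by move=> i; rewrite ffunE; case: (i == j); rewrite ?oner_neq0.
rewrite /tchar (bigD1 j) //= big1 => [|i ij]; first by rewrite mulr1 ffunE eqxx => /exp2z_eq1.
by rewrite ffunE (negPf ij) exp1rz.
Qed.

(** An invariant p satisfies p(t y) = p(y), so each of its monomials has a
    weight on which every t acts trivially; in characteristic zero this weight
    is 0. *)
Lemma invariantP f : reflect (forall u, u \in msupp (inP f) -> M u) (f \in invariant V).
Proof.
apply: (iffP idP) => [/asboolP inv_f u uf|supM]; last first.
  apply/asboolP => t v Tt.
  rewrite -(coordsK v); move: (invmx P *m v) => z; rewrite rep_act //.
  rewrite -!(point_eval_lin P) !point_evalE.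
  rewrite big_seq [RHS]big_seq; apply: eq_bigr => u /supM /eqP Mu.
  by rewrite act_monomial // Mu tchar0 mul1r.
apply: weight_eq0_char => t Tt; pose g := inP f.
pose q := mextend (fun u => tchar t (weight chi u) *: 'X_[u]) g.
have qg : q = g.
  apply: point_eval_inj => y; transitivity (point_eval g (act chi t y)); last first.
    by rewrite !point_eval_lin -rep_act // inv_f.
  rewrite /q /mextend [RHS]point_evalE /point_eval raddf_sum; apply: eq_bigr => w _ /=.
  by rewrite !mevalZ mevalX act_monomial.
have : q@_u = g@_u by rewrite qg.
rewrite /q /mextend raddf_sum (bigD1_seq u) ?msupp_uniq //= big1 => [|w wu].
  rewrite addr0 !mcoeffZ mcoeffX eqxx mulr1 -[RHS]mulr1.
  by apply: mulfI; rewrite -mcoeff_msupp.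
by rewrite !mcoeffZ mcoeffX (negPf wu) !mulr0.
Qed.

Lemma inv_supp a u : u \in msupp (inP (\val a)) -> M u.
Proof. by move: u; apply/invariantP; apply: valP. Qed.

(** The invariant monomial y^u; the junk value 0 is taken when u is not in M. *)
Definition imon u : inv_ring V := insubd 0 (ofP 'X_[u]).

Lemma imonE u : M u -> \val (imon u) = ofP 'X_[u].
Proof.
move=> Mu; rewrite val_insubd; case: ifPn => // /negP[]; apply/invariantP => w.
by rewrite ofPK msuppX inE => /eqP ->.
Qed.

Lemma inv_expand a :
  a = \sum_(u <- msupp (inP (\val a))) (inP (\val a))@_u *: imon u.
Proof.
apply: val_inj; rewrite raddf_sum /= -[LHS]inPK [in LHS](mpolyE (inP _)) linear_sum /=.
rewrite big_seq [RHS]big_seq; apply: eq_bigr => u /inv_supp Mu.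
by rewrite !linearZ /= imonE.
Qed.

Lemma imonD u v : M u -> M v -> imon (u + v)%MM = imon u * imon v.
Proof.
move=> Mu Mv; apply: val_inj; have Muv : M (u + v)%MM by apply: satD.
by rewrite (imonE Muv) mpolyXD rmorphM /= -(imonE Mu) -(imonE Mv).
Qed.

Lemma imon0 : imon 0%MM = 1.
Proof. by apply: val_inj; rewrite imonE ?mpolyX0 ?rmorph1 //; apply: sat0. Qed.

(** * Flatness of the quotient map *)

Section LatticeFlat.
Hypothesis latM : lattice_closed M.

(** An element of M below w of largest degree is the greatest one, since its
    maximum with another one is still below w. *)
Lemma floor_ex w : exists u, [/\ M u, (u <= w)%MM & forall v, M v -> (v <= w)%MM -> (v <= u)%MM].
Proof.
pose Q k := `[< exists u, [/\ M u, (u <= w)%MM & mdeg u = k] >].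
have exQ : exists k, Q k.
  exists 0%N; apply/asboolP; exists 0%MM; rewrite mdeg0; split=> //; first exact: sat0.
  by apply/mnm_lepP => i; rewrite mnm0E.
have [k|k /asboolP[u [Mu uw <-]] max_u] := ex_maxnP exQ (m := mdeg w).
  by move=> /asboolP[u [_ uw <-]]; apply: mdeg_le.
exists u; split=> // v Mv vw.
have uE : u = mlcm u v.
  apply: mdeg_le_eq; first exact: lem_mlcml.
  apply: max_u; apply/asboolP; exists (mlcm u v).
  by rewrite lem_mlcm uw vw; split=> //; apply: latM.
by rewrite uE lem_mlcmr.
Qed.

Definition mfloor w := sval (cid (floor_ex w)).

Lemma mfloor_in w : M (mfloor w).
Proof. by case: (svalP (cid (floor_ex w))). Qed.
Lemma mfloor_le w : (mfloor w <= w)%MM.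
Proof. by case: (svalP (cid (floor_ex w))). Qed.
Lemma mfloor_max w v : M v -> (v <= w)%MM -> (v <= mfloor w)%MM.
Proof. by case: (svalP (cid (floor_ex w))) => _ _; apply. Qed.

Lemma mfloorD u w : M u -> mfloor (u + w)%MM = (u + mfloor w)%MM.
Proof.
move=> Mu; apply/mnmP => i; apply/anti_leq/andP; split.
  have le_u : (u <= mfloor (u + w))%MM by apply: mfloor_max => //; apply: lem_addr.
  have /mnm_lepP/(_ i) : (mfloor (u + w) - u <= mfloor w)%MM.
    apply: mfloor_max; first by apply: satB => //; apply: mfloor_in.
    apply/mnm_lepP=> j; have /mnm_lepP/(_ j) := mfloor_le (u + w)%MM.
    by rewrite mnmBE mnmDE leq_subLR.
  by rewrite mnmBE mnmDE leq_subLR.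
have /mnm_lepP/(_ i) // : (u + mfloor w <= mfloor (u + w))%MM.
apply: mfloor_max; first by apply: satD => //; apply: mfloor_in.
by apply/mnm_lepP=> j; have /mnm_lepP/(_ j) := mfloor_le w; rewrite !mnmDE leq_add2l.
Qed.

Definition mfrac w := (w - mfloor w)%MM.

(** The e-th coordinate in the basis of K[V] over the invariants formed by the
    monomials y^e whose floor is 0. *)
Definition coordinate e (h : {mpoly K[n]}) : inv_ring V :=
  mextend (fun w => if mfrac w == e then imon (mfloor w) else 0) (inP h).

Lemma coordinate_linear e : linear (coordinate e).
Proof. by move=> c p q; rewrite /coordinate !linearP. Qed.

HB.instance Definition _ e :=
  GRing.isLinear.Build K {mpoly K[n]} (inv_ring V) _ (coordinate e) (coordinate_linear e).

Lemma coordinateX e w : coordinate e (ofP 'X_[w]) = if mfrac w == e then imon (mfloor w) else 0.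
Proof. by rewrite /coordinate ofPK mextendX. Qed.

Lemma mpoly_ofP h : h = \sum_(w <- msupp (inP h)) (inP h)@_w *: ofP 'X_[w].
Proof.
rewrite -[LHS]inPK [in LHS](mpolyE (inP h)) linear_sum /=.
by apply: eq_bigr => w _; rewrite linearZ.
Qed.

(** The coordinates are linear over the invariants because multiplying by y^u
    with u in M translates the floor of an exponent and keeps its
    fractional part. *)
Lemma coordinateM e a h : coordinate e (\val a * h) = a * coordinate e h.
Proof.
rewrite [a in LHS]inv_expand [a in RHS]inv_expand raddf_sum !mulr_suml linear_sum /=.
rewrite big_seq [RHS]big_seq; apply: eq_bigr => u /inv_supp Mu.
rewrite -!scalerAl linearZ /=; congr (_ *: _).
rewrite [h in LHS]mpoly_ofP [h in RHS]mpoly_ofP mulr_sumr !linear_sum mulr_sumr /=.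
apply: eq_bigr => w _; rewrite imonE // -scalerAr !linearZ /= -scalerAr; congr (_ *: _).
rewrite -rmorphM -mpolyXD !coordinateX.
have -> : mfrac (u + w)%MM = mfrac w.
  by rewrite /mfrac mfloorD //; apply/mnmP=> i; rewrite !mnmBE !mnmDE subnDl.
case: (mfrac w == e); last by rewrite mulr0.
by rewrite mfloorD // imonD //; apply: mfloor_in.
Qed.

Lemma coordinate_sum (E : seq 'X_{1..n}) h : uniq E ->
  (forall w, w \in msupp (inP h) -> mfrac w \in E) ->
  h = \sum_(e <- E) \val (coordinate e h) * ofP 'X_[e].
Proof.
move=> uE sE; rewrite [LHS]mpoly_ofP.
transitivity (\sum_(e <- E) \sum_(w <- msupp (inP h))
    (inP h)@_w *: (if mfrac w == e then ofP 'X_[w] else 0)).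
  rewrite exchange_big /= big_seq [RHS]big_seq; apply: eq_bigr => w /sE wE.
  rewrite (bigD1_seq (mfrac w)) //= eqxx big1 ?addr0 // => e /negPf.
  by rewrite eq_sym => ->; rewrite scaler0.
apply: eq_bigr => e _; rewrite /coordinate /mextend raddf_sum mulr_suml.
apply: eq_bigr => w _; rewrite /= -scalerAl; congr (_ *: _).
case: eqP => [<-|_]; last by rewrite mul0r.
rewrite imonE ?mfloor_in // -rmorphM -mpolyXD /mfrac.
by rewrite addmC submK // mfloor_le.
Qed.

(** Tensoring with a free module preserves injections. On elements: expanding
    the second factors in the basis, it suffices that all coefficients in N
    vanish, and this is tested in N' by the bilinear maps
    (x, h) |-> coordinate e h *: x. *)
Lemma lattice_flat : flat_morphism (\val : inv_ring V -> {mpoly K[n]}).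
Proof.
move=> N N' phi phi_inj s s0 Q b [b_lin b_add b_semi].
pose E := undup (flatten [seq [seq mfrac w | w <- msupp (inP x.2)] | x <- s]).
have uE : uniq E by apply: undup_uniq.
have bl0 (y : {mpoly K[n]}) : b 0 y = 0.
  by have := b_lin y (- 1) 0 0; rewrite scaler0 addr0 scaleN1r addNr.
have blD (y : {mpoly K[n]}) x x' : b (x + x') y = b x y + b x' y.
  by have := b_lin y 1 x x'; rewrite !scale1r.
have blZ (y : {mpoly K[n]}) (c : inv_ring V) x : b (c *: x) y = c *: b x y.
  by have := b_lin y c x 0; rewrite addr0 bl0 addr0.
have br0 x : b x 0 = 0.
  by apply: (@addrI _ (b x 0)); rewrite -b_add !addr0.
have bl_sum (y : {mpoly K[n]}) (T : Type) (l : seq T) (F : T -> N) :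
    b (\sum_(i <- l) F i) y = \sum_(i <- l) b (F i) y.
  exact: (big_morph (fun x => b x y) (blD y) (bl0 y)).
have br_sum x (T : Type) (l : seq T) (F : T -> {mpoly K[n]}) :
    b x (\sum_(i <- l) F i) = \sum_(i <- l) b x (F i).
  exact: (big_morph (b x) (b_add x) (br0 x)).
transitivity (\sum_(e <- E) b (\sum_(x <- s) coordinate e x.2 *: x.1) (ofP 'X_[e])).
  under [RHS]eq_bigr => e _ do rewrite bl_sum.
  rewrite exchange_big /= big_seq [RHS]big_seq; apply: eq_bigr => x xs.
  rewrite [X in b _ X](@coordinate_sum E) //; last first.
    move=> w wx; rewrite mem_undup; apply/flattenP.
    by exists [seq mfrac w | w <- msupp (inP x.2)]; [apply/mapP; exists x | apply: map_f].
  by rewrite br_sum; apply: eq_bigr => e _; rewrite b_semi blZ.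
apply: big1_seq => e _; suff -> : \sum_(x <- s) coordinate e x.2 *: x.1 = 0 by [].
apply: phi_inj; rewrite linear0 linear_sum /=.
have bil : bilinear_along (\val : inv_ring V -> {mpoly K[n]})
    (fun (x : N') h => coordinate e h *: x).
  split=> [h c x x'|x h h'|c x h].
  - by rewrite scalerDr !scalerA mulrC.
  - by rewrite raddfD scalerDl.
  - by rewrite coordinateM scalerA.
have := s0 _ _ bil; rewrite big_map /= => E0; rewrite -[RHS]E0.
by apply: eq_bigr => x _; rewrite linearZ.
Qed.

End LatticeFlat.

Section FlatLattice.
Variables (u v : 'X_{1..n}).

(** The invariants in the ideal of K[V] generated by y^u and y^v. *)
Definition monomial_ideal : {pred (inv_ring V)^o} :=
  fun a => all (fun w => (u <= w)%MM || (v <= w)%MM) (msupp (inP (\val a))).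

Fact monomial_ideal_submod : submod_closed monomial_ideal.
Proof.
split=> [|c a b /allP Ia /allP Ib]; first by rewrite unfold_in /= rmorph0 msupp0.
apply/allP => w; rewrite /= rmorphD rmorphM => /msuppD_le; rewrite mem_cat.
case/orP=> [/msuppM_le /allpairsP[[w1 w2] /= [_ wa ->]]|/Ib//].
by case/orP: (Ia _ wa) => le_w; apply/orP; [left|right];
  apply: lepm_trans le_w (lem_addl _ _).
Qed.

HB.instance Definition _ := GRing.isSubmodClosed.Build (inv_ring V) (inv_ring V)^o
  monomial_ideal monomial_ideal_submod.

Record ideal_mod := IdealMod { ideal_val : (inv_ring V)^o; _ : ideal_val \in monomial_ideal }.
HB.instance Definition _ := [isSub for ideal_val].
HB.instance Definition _ := [Choice of ideal_mod by <:].
HB.instance Definition _ := [SubChoice_isSubLmodule of ideal_mod by <:].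

Lemma ideal_valP (c : inv_ring V) (g g' : ideal_mod) :
  inP (\val (\val (c *: g + g') : inv_ring V)) =
  inP (\val c) * inP (\val (\val g : inv_ring V)) + inP (\val (\val g' : inv_ring V)).
Proof.
have -> : \val (c *: g + g') = c * (\val g : inv_ring V) + \val g' :> inv_ring V.
  exact: (linearP (\val : ideal_mod -> (inv_ring V)^o)).
by rewrite -rmorphM -rmorphD.
Qed.

(** The part of p divisible by y^u. *)
Definition above (p : {mpoly K[n]}) : {mpoly K[n]} :=
  mextend (fun w => if (u <= w)%MM then 'X_[w] else 0) p.
HB.instance Definition _ := GRing.Linear.copy above
  (mextend (fun w => if (u <= w)%MM then 'X_[w] else (0 : {mpoly K[n]}))).

Lemma aboveX w : above 'X_[w] = if (u <= w)%MM then 'X_[w] else 0.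
Proof. exact: mextendX. Qed.

Lemma mcoeff_above p w : (above p)@_w = if (u <= w)%MM then p@_w else 0.
Proof.
have off w' : w' != w -> (p@_w' *: (if (u <= w')%MM then 'X_[w'] else 0))@_w = 0.
  move=> ne; rewrite mcoeffZ; case: ifP; rewrite ?mcoeff0 ?mulr0 //.
  by rewrite mcoeffX (negPf ne) mulr0.
rewrite /above /mextend raddf_sum /=.
have [wp|nwp] := boolP (w \in msupp p).
  rewrite (bigD1_seq w) ?msupp_uniq //= big1 => [|w' /off //].
  by rewrite addr0 mcoeffZ; case: ifP; rewrite ?mcoeff0 ?mulr0 // mcoeffX eqxx mulr1.
rewrite memN_msupp_eq0 // if_same big1_seq // => w' /= wp'.
by apply: off; apply: contraNneq nwp => <-.
Qed.

Lemma above_id p : {in msupp p, forall w, (u <= w)%MM} -> above p = p.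
Proof.
move=> up; apply/mpolyP=> w; rewrite mcoeff_above; case: ifPn => // nuw.
by rewrite memN_msupp_eq0 //; apply: contra nuw => /up.
Qed.

Lemma mcoeffM_above0 s (p q : {mpoly K[n]}) : {in msupp p, forall w, ~~ (w <= s)%MM} -> (p * q)@_s = 0.
Proof.
move=> ps; apply: memN_msupp_eq0; apply/negP => /msuppM_le/allpairsP[[w w'] /= [wp _ E]].
by have /negP[] := ps w wp; rewrite E lem_addr.
Qed.

(** Up to multiples of monomials that do not divide y^s, taking the part
    divisible by y^u commutes with the multiplication by invariants c on the
    ideal: a term of c * q that is divisible by y^u and comes from a term of q
    divisible by y^v only has an exponent in M above s = max(u, v), and it is
    not s itself as s is not in M. *)
Lemma aboveM s (c q : {mpoly K[n]}) k : s = mlcm u v -> ~~ M s ->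
  {in msupp c, forall w, M w} -> {in msupp q, forall w, M w && ((u <= w)%MM || (v <= w)%MM)} ->
  (above (c * q) * k)@_s = (above q * c * k)@_s.
Proof.
move=> sE nMs Mc Mq; apply/eqP; rewrite -subr_eq0 -mcoeffB -mulrBl; apply/eqP.
apply: mcoeffM_above0.
have cq1 : above (c * above q) = c * above q.
  apply: above_id => w /msuppM_le/allpairsP[[w1 w2] /= [_ + ->]].
  rewrite mcoeff_msupp mcoeff_above; case: ifP; rewrite ?eqxx // => uw _.
  exact: lepm_trans uw (lem_addl _ _).
have -> : above (c * q) - above q * c = above (c * (q - above q)).
  by rewrite mulrBr raddfB /= cq1 [c * above q]mulrC.
move=> w; rewrite mcoeff_msupp mcoeff_above; case: ifP; rewrite ?eqxx // => uw.
rewrite -mcoeff_msupp => /msuppM_le/allpairsP[[w1 w2] /= [/Mc Mw1 + wE]].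
rewrite mcoeff_msupp mcoeffB mcoeff_above; case: ifP; rewrite ?subrr ?eqxx // => nuw2.
rewrite subr0 -mcoeff_msupp => /Mq/andP[Mw2]; rewrite nuw2 /= => vw2.
apply: contra nMs => ws; suff -> : s = w by rewrite wE; apply: satD.
have sw : (s <= w)%MM.
  by rewrite sE lem_mlcm uw wE (lepm_trans vw2 (lem_addl _ _)).
by apply/mnmP=> i; apply/anti_leq; move/mnm_lepP: sw => ->; move/mnm_lepP: ws => ->.
Qed.

End FlatLattice.

(** Let s = max(u, v) and suppose that s is not in M. In the tensor product of
    the ideal of u and v with K[V], the element
    y^u (x) y^(s - u) - y^v (x) y^(s - v) dies in K[V], so flatness makes it
    zero. But the pairing that sends (g, h) to the linear form
    k |-> coefficient of y^s in (part of g divisible by y^u) * h * k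
    is bilinear over the invariants by aboveM, and takes the value 1 on it. *)
Lemma flat_lattice : flat_morphism (\val : inv_ring V -> {mpoly K[n]}) -> lattice_closed M.
Proof.
move=> flatV u v Mu Mv; apply: contraT => nMs; set s := mlcm u v in nMs *.
have uI : imon u \in monomial_ideal u v.
  by apply/allP => w; rewrite imonE // ofPK msuppX inE => /eqP->; rewrite lepm_refl.
have vI : imon v \in monomial_ideal u v.
  by apply/allP => w; rewrite imonE // ofPK msuppX inE => /eqP->; rewrite lepm_refl orbT.
pose gu : ideal_mod u v := IdealMod uI; pose gv : ideal_mod u v := IdealMod vI.
have msX w w' : (w <= w')%MM -> ofP 'X_[w] * ofP 'X_[w' - w] = ofP 'X_[w'].
  by move=> le_w; rewrite -rmorphM -mpolyXD addmC submK.
pose l := [:: (gu, ofP 'X_[s - u]); (- gv, ofP 'X_[s - v])].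
have l0 : tensor_eq0 (\val : inv_ring V -> {mpoly K[n]})
    [seq ((\val : ideal_mod u v -> (inv_ring V)^o) x.1, x.2) | x <- l].
  move=> Q b [b_lin b_add b_semi].
  have b0 h : b 0 h = 0.
    by have := b_lin h (- 1) 0 0; rewrite scaler0 addr0 scaleN1r addNr.
  have bZ (c : inv_ring V) h : b c h = b 1 (\val c * h).
    rewrite b_semi; have := b_lin h c 1 0; rewrite !addr0 b0 addr0 => <-.
    by congr (b _ h); rewrite -[LHS]mulr1.
  have bN (c : inv_ring V) h : b (- c) h = - b c h.
    by have := b_lin h (- 1) c 0; rewrite !addr0 b0 addr0 !scaleN1r.
  transitivity (b (imon u) (ofP 'X_[s - u]) + b (- imon v) (ofP 'X_[s - v])).
    by rewrite !map_cons !big_cons big_nil addr0; congr (_ + b _ _).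
  by rewrite bN (bZ (imon u)) (bZ (imon v)) !imonE // !msX ?subrr // ?lem_mlcml ?lem_mlcmr.
pose iota : {rmorphism inv_ring V -> {mpoly K[n]}} := (inP \o (\val : inv_ring V -> {mpoly K[n]})).
pose beta (g : ideal_mod u v) (h : {mpoly K[n]}) : dual_mod iota :=
  fun w => (above u (inP (\val (\val g))) * inP h * 'X_[w])@_s.
have mI (g : ideal_mod u v) : {in msupp (inP (\val (\val g))),
    forall w, M w && ((u <= w)%MM || (v <= w)%MM)}.
  by move=> w wg; rewrite (inv_supp wg) (allP (valP g) w wg).
have beta_bil : bilinear_along (\val : inv_ring V -> {mpoly K[n]}) beta.
  split=> [h c g g'|g h h'|c g h].
  - apply: funext => k; rewrite /beta.
    rewrite ideal_valP linearD /= !mulrDl mcoeffD; congr (_ + _).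
    rewrite -[RHS]/(mextend (beta g h) (inP (\val c) * 'X_[k])) mextend_coefM.
    rewrite -mulrA (aboveM _ erefl nMs (@inv_supp c) (@mI g)).
    by rewrite -!mulrA (mulrCA (inP (\val c))).
  - by apply: funext => k; rewrite /beta rmorphD mulrDr mulrDl mcoeffD.
  - apply: funext => k; rewrite /beta.
    rewrite -[RHS]/(mextend (beta g h) (inP (\val c) * 'X_[k])) mextend_coefM rmorphM.
    by rewrite -!mulrA (mulrCA (inP (\val c))).
have E := flatV _ _ (\val : ideal_mod u v -> (inv_ring V)^o) val_inj l l0 _ beta beta_bil.
have {}E : beta gu (ofP 'X_[s - u]) + beta (- gv) (ofP 'X_[s - v]) = 0.
  by rewrite -[RHS]E big_cons big_seq1.
have {}E : beta gu (ofP 'X_[s - u]) 0%MM + beta (- gv) (ofP 'X_[s - v]) 0%MM = 0.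
  exact: (congr1 (fun f : 'X_{1..n} -> K => f 0%MM) E).
have betaV : beta (- gv) (ofP 'X_[s - v]) 0%MM = 0.
  rewrite /beta (_ : \val (- gv) = - \val gv); last exact: raddfN.
  rewrite !raddfN /= imonE // ofPK aboveX; case: ifPn => [uv|_]; last first.
    by rewrite oppr0 !mul0r mcoeff0.
  case/negP: nMs; rewrite /s (_ : mlcm u v = v) //; apply/mnmP => i.
  by rewrite mnmE; apply/maxn_idPr; apply/mnm_lepP.
have betaU : beta gu (ofP 'X_[s - u]) 0%MM = 1.
  rewrite /beta /= imonE // !ofPK aboveX lepm_refl mpolyX0 mulr1 -mpolyXD addmC submK ?lem_mlcml //.
  by rewrite mcoeffX eqxx.
by move: E; rewrite betaU betaV addr0 => /eqP; rewrite oner_eq0.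
Qed.

End InvariantRing.

Section Minima.
Variable mu : 'I_n -> 'X_{1..n}.
Hypothesis muP : forall i, least_in M (fun u => u i != 0%N) (mu i).

(** * Smoothness of the quotient *)

(** The invariant ring is the image of the polynomial ring with one variable
    for each distinct minimum; code k is the exponent of the image of the
    monomial of exponent k. *)
Let gens := undup [seq mu i | i <- enum 'I_n].
Let d := size gens.
Let gen (k : 'I_d) : 'X_{1..n} := nth 0%MM gens k.

Let gen_mu k : exists i, gen k = mu i.
Proof.
have : gen k \in gens by apply: mem_nth.
by rewrite mem_undup => /mapP[i _ ->]; exists i.
Qed.

Let gen_in k : M (gen k).
Proof. by have [i ->] := gen_mu k; apply: mu_in muP i. Qed.

Let mu_gen i : exists k, gen k = mu i.
Proof.
have mi : mu i \in gens by rewrite mem_undup map_f ?mem_enum.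
have lt_k : (index (mu i) gens < d)%N by rewrite index_mem.
by exists (Ordinal lt_k); rewrite /gen nth_index.
Qed.

Let gen_inj : injective gen.
Proof. by move=> k l /eqP; rewrite nth_uniq ?undup_uniq // => /eqP/val_inj. Qed.

Let code (k : 'X_{1..d}) : 'X_{1..n} := (\sum_j gen j *+ k j)%MM.

Let codeD k l : code (k + l)%MM = (code k + code l)%MM.
Proof.
apply/mnmP=> i; rewrite mnmDE /code !mnm_sumE -big_split; apply: eq_bigr => j _ /=.
by rewrite !mulmnE mnmDE mulnDr.
Qed.

Let code1 j : code U_(j)%MM = gen j.
Proof.
apply/mnmP=> i; rewrite /code mnm_sumE (bigD1 j) //= big1 => [|l lj].
  by rewrite mulmnE mnm1E eqxx muln1 addn0.
by rewrite mulmnE mnm1E eq_sym (negPf lj) muln0.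
Qed.

Let code_in k : M (code k).
Proof.
apply: (sat_sum satM) => j _; elim: (k j) => [|m IHm]; first by rewrite mulm0n; apply: sat0.
by rewrite mulmS; apply: (satD satM).
Qed.

(** The exponent k j is read off at a coordinate of the j-th block. *)
Let code_inj : injective code.
Proof.
move=> k l /mnmP kl; apply/mnmP => j; have [i gi] := gen_mu j.
have codeE (m : 'X_{1..d}) : code m i = (mu i i * m j)%N.
  rewrite /code mnm_sumE (bigD1 j) //= big1 => [|j' jj'].
    by rewrite addn0 mulmnE gi.
  rewrite mulmnE; suff -> : gen j' i = 0%N by rewrite mul0n.
  apply/eqP; apply: contraNT jj'; have [i' gi'] := gen_mu j'; rewrite gi' => mi.
  by apply/eqP/gen_inj; rewrite gi gi' (mu_block satM muP mi).
have := kl i; rewrite !codeE => /eqP; rewrite eqn_pmul2l ?lt0n ?(mu_diag muP) //.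
by move/eqP.
Qed.

Let code_surj u : M u -> exists k, code k = u.
Proof.
move=> Mu; elim/(mu_induction satM muP): Mu => [|i v _ [k <-]].
  exists 0%MM; apply/mnmP=> i; rewrite /code mnm_sumE mnm0E big1 // => j _.
  by rewrite mulmnE mnm0E muln0.
have [j <-] := mu_gen i; exists (U_(j) + k)%MM.
by rewrite codeD code1.
Qed.

Let pres : {lrmorphism {mpoly K[d]} -> inv_ring V} := meval_alg (fun j => imon (gen j)).

Let presX k : pres 'X_[k] = imon (code k).
Proof.
rewrite [LHS](meval_algX _ k).
have pow u m : M u -> M (u *+ m)%MM /\ imon (u *+ m)%MM = imon u ^+ m.
  move=> Mu; elim: m => [|m [Mm IHm]].
    by rewrite mulm0n imon0 expr0; split=> //; apply: sat0.
  by rewrite mulmS imonD // IHm exprS; split=> //; apply: (satD satM).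
suff : M (code k) /\ imon (code k) = \prod_i imon (gen i) ^+ k i by case.
rewrite /code; elim/big_rec2: _ => [|j x y _ [My Ey]].
  by rewrite imon0; split=> //; apply: sat0.
have [Mj Ej] := pow (gen j) (k j) (gen_in j).
by rewrite imonD // Ej Ey; split=> //; apply: (satD satM).
Qed.

Let pres_inj : injective pres.
Proof.
apply: raddf_inj => p /(congr1 (fun a => lin_subst P (\val a))) /=.
rewrite [lin_subst P 0]rmorph0 => p0; apply/mpolyP => k; rewrite mcoeff0.
have : (lin_subst P (\val (pres p)))@_(code k) = 0 by rewrite p0 mcoeff0.
suff -> : lin_subst P (\val (pres p)) = mextend (fun k => 'X_[code k]) p.
  rewrite /mextend raddf_sum /= => E.
  have [kp|/memN_msupp_eq0 //] := boolP (k \in msupp p).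
  move: E; rewrite (bigD1_seq k) ?msupp_uniq //= big1 => [|l lk].
    by rewrite addr0 mcoeffZ mcoeffX eqxx mulr1.
  by rewrite mcoeffZ mcoeffX (inj_eq code_inj) (negPf lk) mulr0.
pose incl : {linear inv_ring V -> {mpoly K[n]}} := \val.
move: p {p0}; apply: (@linear_mpoly_eq _ _ _ (lin_subst P \o incl \o pres) (mextend _)) => k' /=.
by rewrite presX mextendX /incl /= imonE ?ofPK //; apply: code_in.
Qed.

Let pres_surj a : exists p, pres p = a.
Proof.
pose g := lin_subst P (\val a).
have kex (u : 'X_{1..n}) : exists k, M u -> code k = u.
  have [/code_surj[k <-]|nMu] := boolP (M u); first by exists k.
  by exists 0%MM => Mu; case/negP: nMu.
exists (\sum_(u <- msupp g) g@_u *: 'X_[sval (cid (kex u))]).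
rewrite linear_sum [RHS]inv_expand; rewrite big_seq [RHS]big_seq.
apply: eq_bigr => u /inv_supp Mu.
by rewrite linearZ /= presX (svalP (cid (kex u)) Mu).
Qed.

Lemma minima_coregular : coregular V.
Proof.
split.
  exists d, pres, [::]; split=> [a|p]; first exact: pres_surj.
  split=> [p0|[c ->]]; last by rewrite big_ord0 rmorph0.
  by exists (fun=> 0); rewrite big_ord0; apply: pres_inj; rewrite rmorph0.
apply: (formally_smooth_iso (q := pres)); last exact: mpoly_formally_smooth.
pose g a := sval (cid (pres_surj a)).
have gK : cancel g pres by move=> a; apply: (svalP (cid (pres_surj a))).
by exists g => // p; apply: pres_inj; rewrite gK.
Qed.

End Minima.

(** * Components of the strictly semistable locus *)

Section QuotientGeometry.
Implicit Types (v : 'cV[K]_n) (u w : 'X_{1..n}) (a b f : inv_ring V) (x : quotient_pt V).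

Lemma eval_invE v a : eval_inv v a = point_eval (inP (\val a)) (coords v).
Proof. by rewrite point_eval_lin coordsK. Qed.

Lemma quotient_evalE v a : qev a (pi v) = point_eval (inP (\val a)) (coords v).
Proof. exact: eval_invE. Qed.

Lemma quotient_eval_imon v u : M u -> qev (imon u) (pi v) = \prod_i coords v i 0 ^+ u i.
Proof. by move=> Mu; rewrite quotient_evalE imonE // ofPK point_evalX. Qed.

(** The axioms packed with a morphism are propositions, hence irrelevant. *)
Lemma quotient_pt_ext x x' : (forall a, qev a x = qev a x') -> x = x'.
Proof.
case: x x' => [g [[m1] [m2] [m3]]] [h [[l1] [l2] [l3]]] /= gh.
have {gh}E : g = h by apply: funext => a; apply: gh.
case: _ / E in l1 l2 l3 *.
by congr (GRing.LRMorphism.Pack (GRing.LRMorphism.Class _ _ _));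
  f_equal; apply: Prop_irrelevance.
Qed.

Definition coord_sub J : set 'cV[K]_n := [set v | vsupp (coords v) \subset J].

Lemma coord_subP J v : coord_sub J v <-> forall i, i \notin J -> coords v i 0 = 0.
Proof.
split=> [/fintype.subsetP sJ i|v0].
  by apply: contraNeq => vi; apply: sJ; rewrite inE.
by apply/fintype.subsetP => i; rewrite inE; apply: contraR => /v0 ->.
Qed.

Lemma coord_sub_sub J J' : J \subset J' -> coord_sub J `<=` coord_sub J'.
Proof. by move=> sJ v /fintype.subset_trans; apply. Qed.

Definition indicator_point J : 'cV[K]_n := P *m (\col_i (i \in J)%:R).

Lemma vsupp_indicator_point J : vsupp (coords (indicator_point J)) = J.
Proof.
apply/setP => i; rewrite /indicator_point mulKmx // inE mxE.
by case: (i \in J); rewrite ?oner_eq0 ?eqxx.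
Qed.

Lemma indicator_point_sub J J' : coord_sub J' (indicator_point J) = (J \subset J').
Proof. by rewrite /coord_sub /= vsupp_indicator_point. Qed.

Lemma coord_sub_closed J : zclosed ev (coord_sub J).
Proof.
exists [set f | exists2 i, i \notin J & f = lin_subst (invmx P) 'X_i].
have evX i v : ev (lin_subst (invmx P) 'X_i) v = coords v i 0.
  by rewrite point_eval_lin /point_eval mevalXU.
apply/seteqP; split=> [v /coord_subP v0 _ [i iJ ->]|v v0]; first by rewrite evX v0.
by apply/coord_subP => i iJ; rewrite -evX; apply: v0; exists i.
Qed.

Lemma coord_sub_irreducible J : zirreducible ev (coord_sub J).
Proof.
apply: line_closed_irreducible.
  by exists (indicator_point J); rewrite indicator_point_sub.
move=> v w s /coord_subP v0 /coord_subP w0; apply/coord_subP => i iJ.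
move: (v0 i iJ) (w0 i iJ); rewrite mulmxDr -scalemxAr mulmxBr.
move: (coords v) (coords w) => y z y0 z0.
by rewrite !mxE y0 z0 subrr mulr0 addr0.
Qed.

Lemma poly_eval1 v : ev 1 v = 1.
Proof. exact: meval1. Qed.
Lemma poly_evalM (f g : {mpoly K[n]}) v : ev (f * g) v = ev f v * ev g v.
Proof. exact: mevalM. Qed.

(** Setting the coordinates outside J to zero kills exactly the monomials whose
    support is not contained in J. *)
Lemma vanish_coord_sub (p : {mpoly K[n]}) J :
  (forall y, vsupp y \subset J -> ev p y = 0) ->
  forall u, u \in msupp p -> ~~ (esupp u \subset J).
Proof.
move=> p0 u up; pose q := mextend (fun u => if esupp u \subset J then 'X_[u] else (0 : {mpoly K[n]})) p.
have q0 : q = 0.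
  apply: point_eval_inj => y; rewrite [RHS]meval0 -[RHS](p0 (vrestr J y)); last first.
    by rewrite vsupp_restr; apply: finset.subsetIl.
  rewrite /q /mextend [RHS]point_evalE /point_eval raddf_sum; apply: eq_bigr => w _ /=.
  rewrite mevalZ monomial_restr; case: ifP => _; last by rewrite meval0.
  by rewrite -/(point_eval _ _) point_evalX.
apply: contraL up => suJ; rewrite -mcoeff_eq0.
move/(congr1 (mcoeff u)): q0; rewrite mcoeff0 /q /mextend raddf_sum /=.
have [up|/memN_msupp_eq0-> //] := boolP (u \in msupp p).
rewrite (bigD1_seq u) ?msupp_uniq //= suJ mcoeffZ mcoeffX eqxx mulr1 big1 ?addr0 => [->//|w wu].
by rewrite mcoeffZ; case: ifP; rewrite ?mcoeff0 ?mulr0 // mcoeffX (negPf wu) mulr0.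
Qed.

Lemma vanish_image J a : (forall x, (pi @` coord_sub J) x -> qev a x = 0) <->
  forall u, u \in msupp (inP (\val a)) -> ~~ (esupp u \subset J).
Proof.
split=> [a0|sa _ [v /= vJ <-]].
  apply: vanish_coord_sub => y yJ; rewrite -(mulKmx Pu y) -quotient_evalE.
  by apply: a0; exists (P *m y) => //; rewrite /coord_sub /= mulKmx.
rewrite quotient_evalE point_evalE big_seq big1 // => u /sa nuJ.
apply/eqP; rewrite mulf_eq0; apply/orP; right; rewrite -[_ == _]negbK monomial_neq0.
by apply: contra nuJ => /fintype.subset_trans; apply.
Qed.

Lemma sssP v : sss_locus V v <-> ~ spanning M (vsupp (coords v)).
Proof. by split; apply: contra_not => /stable_vectorP. Qed.

Lemma stable_rep_spanning : stable_rep V -> spanning M finset.setT.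
Proof.
by move=> [v /stable_vectorP]; apply: spanning_sub; rewrite ?finset.subsetT.
Qed.

Lemma nonspanning_sub_sss J : ~ spanning M J -> coord_sub J `<=` sss_locus V.
Proof.
by move=> nsJ v vJ; apply/sssP; apply: contra_not nsJ; apply: (spanning_sub satM).
Qed.

(** The locus is the finite union of the coordinate subspaces of its supports. *)
Lemma irreducible_sss Y : zirreducible ev Y -> Y `<=` sss_locus V ->
  exists2 J, max_nonspanning M J & Y `<=` coord_sub J.
Proof.
move=> irrY sY; pose s := [seq J <- enum {set 'I_n} | `[< ~ spanning M J >]].
have [|J] := zirreducible_union poly_eval1 poly_evalM (s := s) irrY coord_sub_closed.
  move=> v /sY/sssP nsv; exists (vsupp (coords v)) => //.
    by rewrite mem_filter mem_enum andbT; apply/asboolP.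
  by rewrite /coord_sub /=.
rewrite mem_filter => /andP[/asboolP nsJ _] YJ.
have [J' maxJ' sJJ'] := ex_max_nonspanning nsJ.
by exists J' => // v /YJ; apply: coord_sub_sub.
Qed.

Lemma sss_component J : max_nonspanning M J ->
  zcomponent ev (sss_locus V) (coord_sub J).
Proof.
move=> [nsJ maxJ]; split; [exact: nonspanning_sub_sss | exact: coord_sub_irreducible |].
move=> Y irrY sJY /(irreducible_sss irrY)[J' [nsJ' _] sYJ'].
have sJJ' : J \subset J'.
  by rewrite -indicator_point_sub; apply/sYJ'/sJY; rewrite indicator_point_sub.
by apply/seteqP; split=> //; rewrite -(maxJ J' nsJ' sJJ').
Qed.

Lemma sss_componentP Z : zcomponent ev (sss_locus V) Z ->
  exists2 J, max_nonspanning M J & Z = coord_sub J.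
Proof.
move=> [sZ irrZ maxZ]; have [J maxJ sZJ] := irreducible_sss irrZ sZ.
exists J => //; apply/esym/maxZ => //; first exact: coord_sub_irreducible.
by apply: nonspanning_sub_sss; case: maxJ.
Qed.

(** Let f generate the ideal of the image of K^J and let m have least degree
    among the exponents in M with support not contained in J. Then f divides
    y^m, while all terms of f have degree at least that of m: so f is a scalar
    multiple of y^m, and y^m divides all the y^u of the ideal. *)
Lemma principal_least J : stable_rep V -> max_nonspanning M J ->
  principal_divisor (pi @` coord_sub J) ->
  exists m, least_in M (fun u => ~~ (esupp u \subset J)) m.
Proof.
move=> stV [nsJ maxJ] [_ [f [/eqP f0 idealf]]].
have [|m [Mm mJ] min_m] := @ex_mdeg_min n (fun u => M u /\ ~~ (esupp u \subset J)).
  have [u Mu su] := spanning_supp satM (stable_rep_spanning stV).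
  exists u; rewrite su finset.subTset; split=> //.
  by apply/eqP => JT; apply: nsJ; rewrite JT; apply: stable_rep_spanning.
have in_ideal a : (forall u, u \in msupp (inP (\val a)) -> ~~ (esupp u \subset J)) <->
    exists b, a = b * f.
  by split=> [/(vanish_image J a)/idealf|/idealf/vanish_image].
have supp_imon u : M u -> inP (\val (imon u)) = 'X_[u].
  by move=> Mu; rewrite imonE // ofPK.
have mul_f u : M u -> ~~ (esupp u \subset J) ->
    exists q, 'X_[u] = q * inP (\val f).
  move=> Mu uJ; have [|b bE] := (in_ideal (imon u)).1.
    by move=> w; rewrite supp_imon // msuppX inE => /eqP->.
  by exists (inP (\val b)); rewrite -supp_imon // bE -rmorphM.
have f_supp w : w \in msupp (inP (\val f)) -> M w /\ ~~ (esupp w \subset J).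
  move=> wf; split; first exact: inv_supp wf.
  by move: w wf; apply/in_ideal; exists 1; rewrite mul1r.
have p0 : inP (\val f) != 0.
  by apply: contra_neq f0 => p0; apply: val_inj; rewrite -[LHS]inPK p0 rmorph0.
have [q qE] := mul_f m Mm mJ.
have q0 : q != 0.
  apply: contra_eq_neq qE => ->; rewrite mul0r.
  by rewrite -msupp_eq0 msuppX.
have lt_p : (mdeg m < msize (inP (\val f)))%N.
  have lp := mlead_supp p0; have [Ml lJ] := f_supp _ lp.
  exact: leq_ltn_trans (min_m _ (conj Ml lJ)) (msize_mdeg_lt lp).
have sq : (msize q <= 1)%N.
  have := congr1 (fun g => msize g) qE; rewrite msizeX msizeM // => E.
  move: E lt_p; move: (msize q) (msize (inP (\val f))) => k l; lia.
have qC := msize1_polyC sq; set c := q@_0 in qC.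
have c0 : c != 0 by apply: contra_neq q0 => c0; rewrite qC c0 mpolyC0.
exists m; split=> // u Mu uJ; have [q' q'E] := mul_f u Mu uJ.
have : u \in msupp (q' * 'X_[m]).
  rewrite qE qC mul_mpolyC -scalerAr -q'E mcoeff_msupp mcoeffZ mcoeffX eqxx mulr1.
  exact: c0.
move=> /msuppM_le/allpairsP[[w w'] /= [_ + ->]].
by rewrite msuppX inE => /eqP->; apply: lem_addl.
Qed.

Lemma coprincipal_minima : coprincipal V -> has_minima M.
Proof.
move=> [[stV _] prV]; apply: (max_nonspanning_minima satM).
  exact: stable_rep_spanning.
by move=> J maxJ; apply: principal_least => //; apply/prV/sss_component.
Qed.

(** * Divisors of the quotient *)

Section MinimaQuotient.
Variable mu : 'I_n -> 'X_{1..n}.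
Hypothesis muP : forall i, least_in M (fun u => u i != 0%N) (mu i).
Hypothesis stV : stable_rep V.

Lemma qev1 x : qev 1 x = 1. Proof. exact: rmorph1. Qed.
Lemma qevM a b x : qev (a * b) x = qev a x * qev b x. Proof. exact: rmorphM. Qed.

Lemma qev_eq x x' : (forall u, M u -> qev (imon u) x = qev (imon u) x') -> x = x'.
Proof.
move=> xx'; apply: quotient_pt_ext => a; rewrite (inv_expand a) /quotient_eval !linear_sum.
rewrite big_seq [RHS]big_seq; apply: eq_bigr => u /inv_supp Mu.
by rewrite !linearZ /=; congr (_ * _); apply: xx'.
Qed.

(** Give all coordinates of a block the same value, a root of degree |mu i| of
    the value of x at y^(mu i). *)
Lemma quotient_map_root x : exists2 y : 'cV[K]_n,
  pi (P *m y) = x & forall i, qev (imon (mu i)) x = 0 -> y i 0 = 0.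
Proof.
have rt_ex (m : 'X_{1..n}) : exists z : K, (0 < mdeg m)%N -> z ^+ mdeg m = qev (imon m) x.
  have [|m0] := ltnP 0 (mdeg m); last by exists 0.
  by move=> /(root_exists (qev (imon m) x))[z zE]; exists z.
pose rt m := sval (cid (rt_ex m)).
have rtE m : (0 < mdeg m)%N -> rt m ^+ mdeg m = qev (imon m) x.
  exact: (svalP (cid (rt_ex m))).
have mu_gt0 i : (0 < mdeg (mu i))%N.
  rewrite lt0n mdeg_eq0; apply: contraNneq (mu_diag muP i) => ->.
  by rewrite mnm0E.
exists (\col_i rt (mu i)) => [|i]; last first.
  by rewrite -rtE // mxE => /eqP; rewrite expf_eq0 mu_gt0 => /eqP.
apply: qev_eq => u Mu; rewrite quotient_eval_imon // mulKmx //.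
elim/(mu_induction satM muP): Mu => [|i {}u Mu IHu].
  by rewrite imon0 qev1 big1 // => i _; rewrite mnm0E.
rewrite imonD ?(mu_in muP) // qevM -IHu.
rewrite -rtE // mdegE -prodrXr -big_split; apply: eq_bigr => j _ /=.
rewrite mxE mnmDE exprD; congr (_ * _).
have [->|mij] := eqVneq (mu i j) 0%N; first by rewrite !expr0.
by rewrite (mu_block satM muP mij).
Qed.

Lemma quotient_map_surj x : exists v, pi v = x.
Proof. by have [y <- _] := quotient_map_root x; exists (P *m y). Qed.

Definition wall c : set 'cV[K]_n := coord_sub (~: [set c])%SET.
Definition divisor c : set (quotient_pt V) := [set x | qev (imon (mu c)) x = 0].

Lemma divisorE c x : divisor c x = (qev (imon (mu c)) x = 0). Proof. by []. Qed.

Lemma wallP c v : wall c v <-> coords v c 0 = 0.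
Proof.
split=> [/coord_subP|v0]; first by apply; rewrite !inE eqxx.
by apply/coord_subP => i; rewrite !inE negbK => /eqP->.
Qed.

Lemma image_wall c : pi @` wall c = divisor c.
Proof.
have Mc := mu_in muP c.
apply/seteqP; split=> [_ [v /wallP vc <-]|x xc].
  rewrite divisorE quotient_eval_imon // (bigD1 c) //= vc expr0n.
  by rewrite (negPf (mu_diag muP c)) mul0r.
have [y yx y0] := quotient_map_root x; exists (P *m y) => //.
by apply/wallP; rewrite mulKmx // y0.
Qed.

Lemma imon_neq0 u : M u -> imon u <> 0.
Proof.
move=> Mu /(congr1 (fun a => inP (\val a))); rewrite /= imonE // ofPK rmorph0.
by move/eqP; rewrite -msupp_eq0 msuppX.
Qed.

(** The invariants that vanish on the hyperplane y_c = 0 are those whose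
    exponents u satisfy u_c > 0, that is mu c <= u. *)
Lemma divisor_ideal c a : (forall x, divisor c x -> qev a x = 0) <->
  exists b, a = b * imon (mu c).
Proof.
have Mc := mu_in muP c; rewrite -image_wall; split.
  move/vanish_image => sa.
  pose g := inP (\val a).
  exists (\sum_(u <- msupp g) g@_u *: imon (u - mu c)%MM).
  rewrite {1}(inv_expand a) mulr_suml big_seq [RHS]big_seq; apply: eq_bigr => u ug.
  have Mu := inv_supp ug; have uc : u c != 0%N by rewrite -esupp_setC1; apply: sa.
  have le_u := mu_le muP Mu uc.
  have Mb : M (u - mu c)%MM by apply: (satB satM).
  by rewrite -scalerAl -(imonD Mb Mc) (submK le_u).
move=> [b ->] _ [v /wallP vc <-].
rewrite qevM quotient_eval_imon //.
by rewrite (bigD1 c) //= vc expr0n (negPf (mu_diag muP c)) mul0r mulr0.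
Qed.

Lemma divisor_closed c : zclosed qev (divisor c).
Proof.
exists [set imon (mu c)]; apply/seteqP; split=> [x xc _ -> //|x].
by apply.
Qed.

Lemma quotient_map_closed C : zclosed qev C -> zclosed ev (pi @^-1` C).
Proof.
move=> [S ->]; exists [set f | exists2 a, S a & f = \val a].
apply/seteqP; split=> [v Cv _ [a Sa ->]|v Sv a Sa]; first exact: (Cv a Sa).
by apply: Sv; exists a.
Qed.

Lemma image_irreducible Z : zirreducible ev Z -> zirreducible qev (pi @` Z).
Proof.
move=> [[v Zv] irrZ]; split; first by exists (pi v), v.
move=> C D /quotient_map_closed clC /quotient_map_closed clD sub.
have [|sC|sD] := irrZ _ _ clC clD.
- by move=> w Zw; apply: sub; exists w.
- by left=> _ [w Zw <-]; apply: sC.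
- by right=> _ [w Zw <-]; apply: sD.
Qed.

Lemma divisor_irreducible c : zirreducible qev (divisor c).
Proof. by rewrite -image_wall; apply/image_irreducible/coord_sub_irreducible. Qed.

Lemma quotient_irreducible : zirreducible qev setT.
Proof.
rewrite (_ : setT = pi @` coord_sub finset.setT).
  by apply/image_irreducible/coord_sub_irreducible.
apply/seteqP; split=> // x _; have [v <-] := quotient_map_surj x.
by exists v => //; rewrite /coord_sub /= finset.subsetT.
Qed.

(** A nonzero invariant of least degree vanishing on Z is divisible by
    y^(mu c); Z is irreducible and larger than the divisor, so the quotient
    also vanishes on Z, against minimality. *)
Lemma above_divisor c Z : zclosed qev Z -> zirreducible qev Z ->
  divisor c `<=` Z -> Z <> divisor c -> Z = setT.
Proof.
move=> [S ->] [_ irrZ] sub neZ; set Z' := zlocus _ _ in irrZ sub neZ *.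
apply: contrapT => nT.
pose bad k := `[< exists a, [/\ a <> 0, forall x, Z' x -> qev a x = 0 & msize (\val a) = k] >].
have exbad : exists k, bad k.
  apply: contrapT => nobad; apply: nT; apply/seteqP; split=> // x _ a Sa.
  have [->|/eqP a0] := eqVneq a 0; first by rewrite /quotient_eval rmorph0.
  case: nobad; exists (msize (\val a)); apply/asboolP; exists a; split=> // y Zy.
  exact: Zy.
have [k /asboolP[a [a0 aZ <-]] min_k] := ex_minnP exbad.
have [b bE] := (divisor_ideal c a).1 (fun x xc => aZ x (sub x xc)).
have b0 : b <> 0 by move=> b0; apply: a0; rewrite bE b0 mul0r.
have clZb : zclosed qev [set x | qev b x = 0].
  exists [set b]; apply/seteqP; split=> [x xb _ -> //|x].
  by apply.
have [|sZ|sZ] := irrZ _ _ (divisor_closed c) clZb.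
- move=> x /aZ; rewrite bE qevM => /eqP.
  by rewrite mulf_eq0 => /orP[/eqP xb|/eqP xc]; [right|left].
- by apply: neZ; apply/seteqP.
have Mc := mu_in muP c.
have : (msize (\val a) <= msize (\val b))%N.
  by apply: min_k; apply/asboolP; exists b.
have nz (d : inv_ring V) : d <> 0 -> \val d != 0.
  by move=> d0; apply/eqP => vd; apply: d0; apply: val_inj.
rewrite bE rmorphM msizeM ?nz //; last exact: imon_neq0.
suff : (1 < msize (\val (imon (mu c))))%N.
  have := nz b b0; rewrite -msize_poly_eq0.
  by move: (msize (\val b)) (msize (\val (imon (mu c)))) => kb km; lia.
rewrite ltnNge; apply/negP => /msize1_polyC E.
have := congr1 inP E; rewrite imonE // ofPK.
have -> (z : K) : inP z%:MP = z%:MP by apply: comp_mpolyC.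
move/(congr1 (mcoeff (mu c))); rewrite mcoeffX eqxx mcoeffC.
have -> : (mu c == 0%MM) = false.
  by apply/eqP => mc0; have := mu_diag muP c; rewrite mc0 mnm0E.
by rewrite mulr0 => /eqP; rewrite oner_eq0.
Qed.

(** The only irreducible closed set strictly above the divisor is the whole
    quotient, which is irreducible as the image of V. *)
Lemma divisor_codim c : zcodim qev (divisor c) 1.
Proof.
have neT : divisor c <> setT.
  move=> E; have [v vE] : exists v, coords v = const_mx 1.
    by exists (P *m const_mx 1); rewrite mulKmx.
  have : divisor c (pi v) by rewrite E.
  rewrite divisorE quotient_eval_imon ?(mu_in muP) // vE.
  rewrite big1 => [/eqP|i _]; first by rewrite oner_eq0.
  by rewrite mxE expr1n.
have clT : zclosed qev setT.
  by exists set0; apply/seteqP; split=> // x _ a [].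
split.
  exists (fun k => if k is 0%N then divisor c else setT); split=> //.
    move=> [|k] _; first by split; [exact: divisor_closed|exact: divisor_irreducible].
    by split=> //; exact: quotient_irreducible.
  by move=> [|k] // _; split.
move=> m Z [Z0 irrZ strZ]; rewrite leqNgt; apply/negP => m1.
have [s01 ne01] := strZ 0%N (ltnW m1); have [s12 ne12] := strZ 1%N m1.
have [cl1 irr1] := irrZ 1%N (ltnW m1).
have Z1 : Z 1%N = setT.
  by apply: (above_divisor (c := c)) => //; rewrite -Z0 // => /esym.
by apply: ne12; rewrite Z1; apply/seteqP; split=> // x _; apply: s12; rewrite Z1.
Qed.

(** By minima_spanning a nonspanning J misses some c whose complement is not
    spanning, and maximality makes J this complement. *)
Lemma max_nonspanning_wall J : max_nonspanning M J ->
  exists2 c, J = (~: [set c])%SET & ~ spanning M (~: [set c])%SET.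
Proof.
move=> [nsJ maxJ].
have [c cJ nsc] : exists2 c, c \notin J & ~ spanning M (~: [set c])%SET.
  apply: contrapT => no_c; apply: nsJ; apply: (minima_spanning satM muP) => c cJ.
  by apply: contrapT => nsc; apply: no_c; exists c.
exists c => //; apply/esym/maxJ => //; apply/fintype.subsetP => i iJ.
by rewrite !inE; apply: contraNneq cJ => <-.
Qed.

Lemma divisor_sub_image c : ~ spanning M (~: [set c])%SET ->
  divisor c `<=` pi @` sss_locus V.
Proof.
move=> nsc; rewrite -image_wall => _ [v vc <-].
by exists v => //; apply: nonspanning_sub_sss nsc _ vc.
Qed.

Lemma irreducible_image_sss Y : zirreducible qev Y -> Y `<=` pi @` sss_locus V ->
  exists2 c, ~ spanning M (~: [set c])%SET & Y `<=` divisor c.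
Proof.
move=> irrY sY; pose s := [seq c <- enum 'I_n | `[< ~ spanning M (~: [set c])%SET >]].
have [|c] := zirreducible_union qev1 qevM (s := s) irrY divisor_closed.
  move=> x /sY[v /sssP nsv <-].
  have [J maxJ sJ] := ex_max_nonspanning nsv.
  have [c JE nsc] := max_nonspanning_wall maxJ.
  exists c; first by rewrite mem_filter mem_enum andbT; apply/asboolP.
  by rewrite -image_wall; exists v => //; rewrite /wall -JE.
by rewrite mem_filter => /andP[/asboolP nsc _]; exists c.
Qed.

Lemma minima_coprincipal : coprincipal V.
Proof.
split.
  split=> // Y [sY irrY maxY]; have [c nsc sYc] := irreducible_image_sss irrY sY.
  rewrite -(maxY _ (divisor_irreducible c) sYc (divisor_sub_image nsc)).
  exact: divisor_codim.
move=> Z /sss_componentP[J /max_nonspanning_wall[c -> nsc] ->].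
rewrite -/(wall c) image_wall; split; first exact: divisor_closed.
exists (imon (mu c)); split; first exact: (imon_neq0 (mu_in muP c)).
exact: divisor_ideal.
Qed.

End MinimaQuotient.

End QuotientGeometry.

End DiagonalizedRepresentation.

(** * The equivalence *)

Theorem theorem1p6 (K : closedFieldType) (hK : [pchar K]%R =i pred0)
  (r n : nat) (V : torus_rep K r n) (hV : stable_rep V) :
  cofree V <-> coprincipal V.
Proof.
have [P [chi [Pu VE]]] := torus_rep_diag V.
have satM := relations_saturated chi.
have mu_of : has_minima (relations chi) ->
    exists mu, forall i, least_in (relations chi) (fun u => u i != 0%N) (mu i).
  by move=> minM; exists (fun i => sval (cid (minM i))) => i; case: (cid (minM i)).
split=> [[_ flatV]|coprV].
  have latM := flat_lattice hK Pu VE flatV.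
  have [mu muP] : exists mu, forall i,
      least_in (relations chi) (fun u => u i != 0%N) (mu i).
    exact/mu_of/(lattice_minima satM)/(stable_rep_spanning Pu VE hV).
  exact: (minima_coprincipal hK Pu VE muP hV).
have [mu muP] := mu_of (coprincipal_minima hK Pu VE coprV).
split; first exact: (minima_coregular hK Pu VE muP).
exact/(lattice_flat hK Pu VE)/(minima_lattice satM muP).
Qed.
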